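(* In the category of smooth manifolds and smooth maps, and likewise in the category of analytic manifolds and analytic maps, the tangent functor monad $(T,\zeta,\tau T+T\tau)$ is the unique monad whose underlying endofunctor is the tangent functor $T$. That is, if $\alpha\colon\mathrm{id}\Rightarrow T$ and $\beta\colon T^2\Rightarrow T$ are natural transformations such that $(T,\alpha,\beta)$ is a monad, then $\alpha=\zeta$ and $\beta=\tau T+T\tau$.
   Context: $\mathbb K=\mathbb R$ or $\mathbb C$; manifolds are modelled on Banach spaces over $\mathbb K$. The tangent functor $T$ sends a manifold $M$ to the total space $TM$ of its tangent bundle (regarded merely as a manifold) and a map $f$ to its tangent map $Tf$. $\zeta_M\colon M\to TM$, $x\mapsto(x,0)$, is the zero section; $\tau_M\colon TM\to M$ is the tangent bundle projection. The natural transformation $\tau T+T\tau\colon T^2\Rightarrow T$ is $\xi\mapsto\tau_{TM}(\xi)+T\tau_M(\xi)$ (sum in the fibre of $TM\to M$); in charts, $(x,v,\dot x,\dot v)\mapsto(x,v+\dot x)$. A monad $(T,\eta,\mu)$ in a category consists of an endofunctor $T$ and natural transformations $\eta\colon\mathrm{id}\Rightarrow T$, $\mu\colon T^2\Rightarrow T$ with $\mu\circ\eta T=\mu\circ T\eta=\mathrm{id}_T$ and $\mu\circ\mu T=\mu\circ T\mu$. *)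

(* Defs.v *)
From HB Require Import structures.
From mathcomp Require Import all_boot all_order all_algebra.
From mathcomp Require Import complex ring zify.
From mathcomp Require Import boolp classical_sets functions cardinality interval_inference reals.
From mathcomp Require Import topology prodnormedzmodule normedtype landau sequences derive.

Set Implicit Arguments.
Unset Strict Implicit.
Unset Printing Implicit Defensive.

Import Order.TTheory GRing.Theory Num.Theory.
Import numFieldNormedType.Exports.

Local Open Scope classical_set_scope.
Local Open Scope ring_scope.

HB.instance Definition _ (E F : puniformType) := Uniform.on (E * F)%type.

Section ProdComplete.
Context (E F : completeType).

Lemma prod_complete (G : set_system (E * F)%type) :
  ProperFilter G -> cauchy G -> cvg G.
Proof.
move=> PG cG.
have c1 : cvg (fst @ G).
  apply: cauchy_cvg => A entA.
  have : entourage [set xy : (E * F) * (E * F) | A (xy.1.1, xy.2.1)].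
    exists (A, setT); first by split=> //; exact: entourageT.
    by move=> [[a b] [c d]] /= [? _]; exists ((a, c), (b, d)).
  move=> /cG [[P Q] /= [GP GQ] PQ].
  exists (fst @` P, fst @` Q) => /=.
    by split; [apply: filterS GP|apply: filterS GQ] => x Px; exists x.
  by move=> [_ _] /= [[x Px <-] [y Qy <-]]; exact: (PQ (x, y)).
have c2 : cvg (snd @ G).
  apply: cauchy_cvg => A entA.
  have : entourage [set xy : (E * F) * (E * F) | A (xy.1.2, xy.2.2)].
    exists (setT, A); first by split=> //; exact: entourageT.
    by move=> [[a b] [c d]] /= [_ ?]; exists ((a, c), (b, d)).
  move=> /cG [[P Q] /= [GP GQ] PQ].
  exists (snd @` P, snd @` Q) => /=.
    by split; [apply: filterS GP|apply: filterS GQ] => x Px; exists x.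
  by move=> [_ _] /= [[x Px <-] [y Qy <-]]; exact: (PQ (x, y)).
apply/cvg_ex; exists (lim (fst @ G), lim (snd @ G)).
have -> : G = (fun p => (p.1, p.2)) @ G.
  apply/seteqP; split=> A; rewrite /fmap /=;
  by have -> : (fun p : E * F => (p.1, p.2)) @^-1` A = A
       by apply/seteqP; split=> -[].
exact: cvg_pair.
Qed.

HB.instance Definition _ :=
  Uniform_isComplete.Build (E * F)%type prod_complete.

End ProdComplete.

HB.instance Definition _ (K : numFieldType) (E F : completeNormedModType K) :=
  Complete.on (E * F)%type.

Section Smooth.
Context (K : numFieldType).
Implicit Types E F G : normedModType K.

(* Smoothness is expressed through iterated differentials: [f] is C^(n+1) on  *)
(* the open set [U] if it is Frechet differentiable on [U] and its            *)
(* differential (x, v) |-> df_x(v) is C^n on U x E. For n = oo, this is the   *)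
(* usual class of infinitely Frechet differentiable maps; over the complex    *)
(* numbers, these are the holomorphic maps.                                   *)
Fixpoint Ck (n : nat) E F (U : set E) (f : E -> F) : Prop :=
  if n is m.+1 then
    (forall x, U x -> differentiable f x) /\
    Ck m (U `*` setT) (fun p : E * E => 'd f (p.1) (p.2))
  else forall x, U x -> {for x, continuous f}.

Definition smooth_on E F (U : set E) (f : E -> F) := forall n, Ck n U f.

Lemma diffP_eps E F (f : E -> F) (df : {linear E -> F}) x : continuous df ->
  (forall e, 0 < e -> \forall h \near 0, `|f (h + x) - f x - df h| <= e * `|h|) ->
  differentiable f x /\ 'd f x = df :> (E -> F).
Proof.
move=> cdf H.
have o : f \o shift x = cst (f x) + df +o_ 0 id.
  apply/eqaddoP => e /H; apply: filterS => h /=.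
  by rewrite !fctE /= opprD addrA.
have dE := diff_unique cdf o; split => //.
by apply/diff_locallyP; rewrite dE.
Qed.

Lemma diff_eps E F (f : E -> F) x : differentiable f x ->
  forall e, 0 < e -> \forall h \near 0, `|f (h + x) - f x - 'd f x h| <= e * `|h|.
Proof.
move=> /diff_locallyP[_] /eqaddoP H e /H; apply: filterS => h /=.
by rewrite !fctE /= opprD addrA.
Qed.

Lemma diff_near E F (f g : E -> F) x : (\forall y \near x, f y = g y) ->
  differentiable f x -> differentiable g x /\ 'd g x = 'd f x :> (E -> F).
Proof.
move=> fg df; apply: diffP_eps; first exact: diff_continuous.
move=> e e0; have fgx := nbhs_singleton fg.
move: fg; rewrite (near_shift 0 x) => fg.
near=> h; rewrite -fgx.
suff -> : g (h + x) = f (h + x) by near: h; exact: diff_eps.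
by near: h; apply: filterS fg => h /=; rewrite subr0.
Unshelve. all: by end_near. Qed.

Lemma diff_near_on E F (f g : E -> F) (U : set E) : open U ->
  (forall x, U x -> f x = g x) -> forall x, U x -> differentiable f x ->
  differentiable g x /\ 'd g x = 'd f x :> (E -> F).
Proof.
move=> oU fg x Ux; apply: diff_near.
by apply: filterS (open_nbhs_nbhs (conj oU Ux)).
Qed.

Lemma openXT E G (U : set E) : open U -> open (U `*` [set: G]).
Proof.
move=> oU; rewrite (_ : _ `*` _ = fst @^-1` U).
  by apply: open_comp => // x _; exact: cvg_fst.
by apply/seteqP; split=> [[a b] []|[a b]].
Qed.

Lemma Ck_ext n E F (U : set E) (f g : E -> F) : open U ->
  (forall x, U x -> f x = g x) -> Ck n U f -> Ck n U g.
Proof.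
elim: n E F U f g => [|n IH] E F U f g oU fg /=.
  move=> cf x Ux; change (g @ x --> g x); rewrite -(fg x Ux).
  apply: cvg_trans (cf x Ux); apply: near_eq_cvg.
  by apply: filterS (open_nbhs_nbhs (conj oU Ux)) => y /fg.
move=> [df Cdf]; split.
  by move=> x Ux; case: (diff_near_on oU fg Ux (df x Ux)).
apply: IH Cdf; first exact: openXT.
by move=> [x v] [/= Ux _]; case: (diff_near_on oU fg Ux (df x Ux)) => _ ->.
Qed.

Lemma Ck_sub n E F (U V : set E) (f : E -> F) : V `<=` U -> Ck n U f -> Ck n V f.
Proof.
elim: n E F U V f => [|n IH] E F U V f VU /=; first by move=> H x /VU /H.
move=> [df Cdf]; split; first by move=> x /VU /df.
by apply: IH Cdf => -[a b] [/= /VU].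
Qed.

Lemma Ck_diff n E F (U : set E) (f : E -> F) x :
  Ck n.+1 U f -> U x -> differentiable f x.
Proof. by case=> + _; apply. Qed.

Lemma diff_linear_comp E F G (f : F -> G) (L : {linear E -> F}) x :
  continuous L -> differentiable f (L x) ->
  differentiable (f \o L) x /\ 'd (f \o L) x = 'd f (L x) \o L :> (E -> G).
Proof.
move=> cL df; have dL : differentiable L x by exact: linear_differentiable.
split; first exact: differentiable_comp.
by rewrite diff_comp // diff_lin.
Qed.

Lemma preimage_open E F (U : set F) (L : E -> F) : continuous L -> open U ->
  open (L @^-1` U).
Proof. by move=> cL oU; apply: open_comp => // x _; exact: cL. Qed.

Lemma Ck_comp_linear n E F G (U : set F) (f : F -> G) (L : {linear E -> F}) :
  open U -> continuous L -> Ck n U f -> Ck n (L @^-1` U) (f \o L).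
Proof.
elim: n E F G U f L => [|n IH] E F G U f L oU cL /=.
  by move=> cf x /cf cfx; apply: continuous_comp => //; exact: cL.
move=> [df Cdf]; split.
  by move=> x /df /(diff_linear_comp cL)[].
pose L2 (p : E * E) := (L p.1, L p.2).
have L2lin : linear L2 by move=> c [a b] [a' b']; rewrite /L2 /= !linearP.
pose L2M := GRing.isLinear.Build _ _ _ _ _ L2lin.
pose L2L : {linear (E * E)%type -> (F * F)%type} := HB.pack L2 L2M.
have cL2 : continuous L2L.
  move=> p.
  have -> : L2L = (fun p => (L p.1, L p.2)) :> (_ -> _) by [].
  apply: cvg_pair.
    by apply: continuous_comp; [exact: cvg_fst|exact: cL].
  by apply: continuous_comp; [exact: cvg_snd|exact: cL].
have := IH _ _ _ _ _ L2L (openXT oU) cL2 Cdf.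
move=> /(Ck_sub (V := (L @^-1` U) `*` setT)) H.
apply: Ck_ext (H _); first exact/openXT/preimage_open.
- by move=> [x v] [/= Ux _]; have [_ ->] := diff_linear_comp cL (df _ Ux).
- by move=> [x v] [/= Ux _].
Qed.

Lemma Ck_pair n E F G (U : set E) (f : E -> F) (g : E -> G) : open U ->
  Ck n U f -> Ck n U g -> Ck n U (fun x => (f x, g x)).
Proof.
elim: n E F G U f g => [|n IH] E F G U f g oU /=.
  by move=> cf cg x Ux; apply: cvg_pair; [exact: cf|exact: cg].
move=> [df Cf] [dg Cg]; split.
  by move=> x Ux; apply: differentiable_pair; [exact: df|exact: dg].
apply: Ck_ext (IH _ _ _ _ _ _ (openXT oU) Cf Cg); first exact: openXT.
by move=> [x v] [/= Ux _]; rewrite diff_pair //; [exact: df|exact: dg].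
Qed.

Definition tangent_fun E F (f : E -> F) (p : E * E) : F * F :=
  (f p.1, 'd f (p.1) (p.2)).

Lemma fst_continuous_lin E F : continuous (@fst E F).
Proof. by move=> p; exact: cvg_fst. Qed.

Lemma smooth_tangent E F (U : set E) (f : E -> F) : open U ->
  smooth_on U f -> smooth_on (U `*` setT) (tangent_fun f).
Proof.
move=> oU sf n; apply: Ck_pair; first exact: openXT.
  apply: (Ck_sub (U := fst @^-1` U)); first by move=> x [].
  pose L : {linear (E * E)%type -> E} := fst.
  by apply: (Ck_comp_linear (L := L)) => //; exact: fst_continuous_lin.
by have [] := sf n.+1.
Qed.

Lemma Ck_linear n E F (U : set E) (L : {linear E -> F}) :
  open U -> continuous L -> Ck n U L.
Proof.
elim: n E F U L => [|n IH] E F U L oU cL /=; first by move=> x _; exact: cL.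
split; first by move=> x _; exact: linear_differentiable.
pose L2 : {linear (E * E)%type -> F} := L \o snd.
have cL2 : continuous L2.
  by move=> p; apply: continuous_comp; [exact: cvg_snd|exact: cL].
apply: Ck_ext (IH _ _ _ L2 (openXT oU) cL2); first exact: openXT.
by move=> [x v] _ /=; rewrite diff_lin.
Qed.

Lemma smooth_linear E F (U : set E) (L : {linear E -> F}) :
  open U -> continuous L -> smooth_on U L.
Proof. by move=> oU cL n; exact: Ck_linear. Qed.

End Smooth.
Section Multilinear.
Context (K : numFieldType).
Implicit Types E F G : normedModType K.

Definition upd (T : Type) n (v : 'I_n -> T) (i : 'I_n) (x : T) : 'I_n -> T :=
  fun j => if j == i then x else v j.

Definition multilinear E F n (a : ('I_n -> E) -> F) :=
  forall (i : 'I_n) (v : 'I_n -> E) (c : K) (x y : E),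
    a (upd v i (c *: x + y)) = c *: a (upd v i x) + a (upd v i y).

(* Convergent power series expansion of [f] around [x]: the n-th term is the  *)
(* homogeneous polynomial h |-> a_n(h, ..., h) with a_n a bounded n-linear    *)
(* map, and the norms of the a_n grow at most geometrically (positive radius  *)
(* of convergence).                                                           *)
Definition analytic_at E F (f : E -> F) (x : E) :=
  exists (a : forall n, ('I_n -> E) -> F) (C r : K),
    [/\ 0 < r,
        forall n, multilinear (a n),
        forall n v, `|a n v| <= C * r^-1 ^+ n * \prod_(i < n) `|v i| &
        forall h, `|h| < r ->
          series (fun n => a n (fun=> h)) @ \oo --> f (x + h)].

Definition analytic_on E F (U : set E) (f : E -> F) :=
  forall x, U x -> analytic_at f x.

Definition fcons (T : Type) n (x : T) (v : 'I_n -> T) : 'I_n.+1 -> T :=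
  fun j => oapp v x (unlift ord0 j).

Definition fins (T : Type) n (i : 'I_n.+1) (x : T) (v : 'I_n -> T) :
  'I_n.+1 -> T := fun j => oapp v x (unlift i j).

Lemma fcons0 T n (x : T) (v : 'I_n -> T) : fcons x v ord0 = x.
Proof. by rewrite /fcons unlift_none. Qed.

Lemma fconsS T n (x : T) (v : 'I_n -> T) i : fcons x v (lift ord0 i) = v i.
Proof. by rewrite /fcons liftK. Qed.

Lemma fcons_const (T : Type) n (x : T) : fcons x (fun=> x) = (fun=> x) :> ('I_n.+1 -> T).
Proof. by apply/funext => j; rewrite /fcons; case: unliftP. Qed.

Lemma fcons_upd0 (T : Type) n (x y : T) (v : 'I_n -> T) :
  upd (fcons x v) ord0 y = fcons y v.
Proof.
apply/funext => j; rewrite /upd; case: (unliftP ord0 j) => [j' ->|->].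
  by rewrite !fconsS -(inj_eq val_inj) /= /bump.
by rewrite eqxx fcons0.
Qed.

Lemma fcons_updS (T : Type) n (x y : T) (v : 'I_n -> T) i :
  upd (fcons x v) (lift ord0 i) y = fcons x (upd v i y).
Proof.
apply/funext => j; rewrite /upd; case: (unliftP ord0 j) => [j' ->|->].
  by rewrite !fconsS (inj_eq lift_inj).
by rewrite !fcons0.
Qed.

Definition Der E F n (a : ('I_n -> E) -> F) (h k : E) : F :=
  \sum_(i < n) a (upd (fun=> h) i k).

Lemma slice_multilinear E F n (a : ('I_n.+1 -> E) -> F) x :
  multilinear a -> multilinear (fun v => a (fcons x v)).
Proof. by move=> ma i v c y z; rewrite -!fcons_updS ma. Qed.

Lemma slice_add E F n (a : ('I_n.+1 -> E) -> F) x y v :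
  multilinear a -> a (fcons (x + y) v) = a (fcons x v) + a (fcons y v).
Proof.
move=> ma; have := ma ord0 (fcons x v) 1 x y.
by rewrite !scale1r !fcons_upd0.
Qed.

Lemma Der_rec E F n (a : ('I_n.+1 -> E) -> F) h k :
  Der a h k = a (fcons k (fun=> h)) + Der (fun v => a (fcons h v)) h k.
Proof.
rewrite /Der big_ord_recl -[X in upd X ord0 k]fcons_const fcons_upd0; congr (_ + _).
by apply: eq_bigr => i _; rewrite -[X in upd X _ k]fcons_const fcons_updS.
Qed.

Lemma DerD E F n (a : ('I_n -> E) -> F) h c k k' : multilinear a ->
  Der a h (c *: k + k') = c *: Der a h k + Der a h k'.
Proof.
by move=> ma; rewrite /Der scaler_sumr -big_split; apply: eq_bigr => i _.
Qed.

Definition mbound E F n (a : ('I_n -> E) -> F) (A : K) :=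
  forall v, `|a v| <= A * \prod_(i < n) `|v i|.

Lemma slice_bound E F n (a : ('I_n.+1 -> E) -> F) A x :
  mbound a A -> mbound (fun v => a (fcons x v)) (A * `|x|).
Proof.
move=> ba v; apply: le_trans (ba _) _; rewrite big_ord_recl fcons0 mulrA.
by under eq_bigr do rewrite fconsS.
Qed.

Lemma mbound_const E F n (a : ('I_n -> E) -> F) A h s :
  0 <= A -> mbound a A -> `|h| <= s -> `|a (fun=> h)| <= A * s ^+ n.
Proof.
move=> A0 ba hs; apply: le_trans (ba _) _; apply: ler_wpM2l => //.
by rewrite prodr_const card_ord lerXn2r // nnegrE // (le_trans _ hs).
Qed.

Section Taylor.
Context (E F : normedModType K) (h k : E) (s u : K).
Context (s0 : 0 <= s) (u0 : 0 <= u) (hs : `|h| <= s) (ks : `|k| <= s * u).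

Lemma Der_bound n (a : ('I_n -> E) -> F) A : 0 <= A -> mbound a A ->
  `|Der a h k| <= A * 2 ^+ n * s ^+ n * u.
Proof.
elim: n a A => [|n IH] a A A0 ba.
  by rewrite /Der big_ord0 normr0 !mulr_ge0 // exprn_ge0.
rewrite Der_rec; apply: le_trans (ler_normD _ _) _.
have A's : 0 <= A * s by rewrite mulr_ge0.
have b1 := mbound_const (mulr_ge0 A0 (normr_ge0 k)) (slice_bound k ba) hs.
have ba' : mbound (fun v => a (fcons h v)) (A * s).
  move=> v; apply: le_trans (slice_bound h ba v) _.
  by rewrite ler_wpM2r ?prodr_ge0 // ler_wpM2l.
have b2 := IH _ _ A's ba'.
apply: le_trans (lerD b1 b2) _.
have b3 : A * `|k| * s ^+ n <= A * 2 ^+ n * s ^+ n.+1 * u.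
  apply: (@le_trans _ _ (A * (s * u) * s ^+ n)).
    by rewrite ler_wpM2r ?exprn_ge0 // ler_wpM2l.
  rewrite (_ : A * (s * u) * s ^+ n = A * s ^+ n.+1 * u); last first.
    by rewrite exprS -!mulrA; congr (_ * _); congr (_ * _); rewrite mulrC.
  rewrite ler_wpM2r // ler_wpM2r ?exprn_ge0 // ler_peMr // exprn_ege1 //.
  by rewrite ler1n.
apply: le_trans (lerD b3 (lexx _)) _.
rewrite le_eqVlt; apply/orP; left; apply/eqP.
rewrite [2 ^+ n.+1]exprS !exprS; ring.
Qed.

Context (u1 : u <= 1).

Let hks : `|h + k| <= 2 * s.
Proof.
apply: le_trans (ler_normD _ _) _; rewrite mulr_natl mulr2n lerD //.
by apply: le_trans ks _; rewrite ler_piMr.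
Qed.

Lemma taylor1 n (a : ('I_n -> E) -> F) A : 0 <= A -> multilinear a ->
  mbound a A -> `|a (fun=> h + k) - a (fun=> h)| <= A * 2 ^+ n * s ^+ n * u.
Proof.
elim: n a A => [|n IH] a A A0 ma ba.
  have -> : (fun=> h + k) = (fun=> h) :> ('I_0 -> E) by apply/funext => -[].
  by rewrite subrr normr0 !mulr_ge0 // exprn_ge0.
rewrite -(fcons_const n (h + k)) slice_add // -(fcons_const n h).
rewrite addrAC.
have A's : 0 <= A * s by rewrite mulr_ge0.
have ba' : mbound (fun v => a (fcons h v)) (A * s).
  move=> v; apply: le_trans (slice_bound h ba v) _.
  by rewrite ler_wpM2r ?prodr_ge0 // ler_wpM2l.
have b1 := IH _ _ A's (slice_multilinear h ma) ba'.
have b2 := mbound_const (mulr_ge0 A0 (normr_ge0 k)) (slice_bound k ba) hks.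
apply: le_trans (ler_normD _ _) _.
apply: le_trans (lerD b1 b2) _.
have b3 : A * `|k| * (2 * s) ^+ n <= A * (s * u) * (2 * s) ^+ n.
  by rewrite ler_wpM2r ?exprn_ge0 ?mulr_ge0 // ler_wpM2l.
apply: le_trans (lerD (lexx _) b3) _.
rewrite le_eqVlt; apply/orP; left; apply/eqP.
rewrite exprMn [2 ^+ n.+1]exprS !exprS; ring.
Qed.

Lemma taylor2 n (a : ('I_n -> E) -> F) A : 0 <= A -> multilinear a ->
  mbound a A -> `|a (fun=> h + k) - a (fun=> h) - Der a h k|
    <= A * 2 ^+ n * s ^+ n * u ^+ 2.
Proof.
elim: n a A => [|n IH] a A A0 ma ba.
  have -> : (fun=> h + k) = (fun=> h) :> ('I_0 -> E) by apply/funext => -[].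
  by rewrite /Der big_ord0 subrr subr0 normr0 !mulr_ge0 // exprn_ge0.
rewrite Der_rec -(fcons_const n (h + k)) slice_add // -(fcons_const n h).
have A's : 0 <= A * s by rewrite mulr_ge0.
have ba' : mbound (fun v => a (fcons h v)) (A * s).
  move=> v; apply: le_trans (slice_bound h ba v) _.
  by rewrite ler_wpM2r ?prodr_ge0 // ler_wpM2l.
have b1 := IH _ _ A's (slice_multilinear h ma) ba'.
have b2 := taylor1 (mulr_ge0 A0 (normr_ge0 k)) (slice_multilinear k ma)
  (slice_bound k ba).
set X := a (fcons h (fun=> h + k)); set Y := a (fcons k (fun=> h + k)).
set Z := a (fcons h (fun=> h)); set V := a (fcons k (fun=> h)).
set D := Der _ h k.
have -> : X + Y - Z - (V + D) = (X - Z - D) + (Y - V).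
  by rewrite opprD !addrA [LHS](ACl (1*3*5*2*4)%AC).
apply: le_trans (ler_normD _ _) _.
apply: le_trans (lerD b1 b2) _.
have b3 : A * `|k| * 2 ^+ n * s ^+ n * u <= A * (s * u) * 2 ^+ n * s ^+ n * u.
  by do 3 (rewrite ler_wpM2r ?exprn_ge0 //); rewrite ler_wpM2l.
apply: le_trans (lerD (lexx _) b3) _.
rewrite le_eqVlt; apply/orP; left; apply/eqP.
rewrite [2 ^+ n.+1]exprS !exprS expr0; ring.
Qed.

End Taylor.

End Multilinear.
Section Analytic.
Context (K : numFieldType).

Definition archi := forall e : K, 0 < e -> exists n, 2^-1 ^+ n < e.

Context (archiK : archi).

Lemma half_ge0 : 0 <= 2^-1 :> K. Proof. by rewrite invr_ge0. Qed.

Lemma geo_tail (m n : nat) : \sum_(m <= i < n) 2^-1 ^+ i <= 2 * 2^-1 ^+ m :> K.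
Proof.
have [nm|mn] := leqP n m.
  by rewrite big_geq // mulr_ge0 // exprn_ge0 // half_ge0.
have H d : \sum_(m <= i < m + d) 2^-1 ^+ i
    = 2 * 2^-1 ^+ m - 2 * 2^-1 ^+ (m + d) :> K.
  elim: d => [|d IH]; first by rewrite addn0 big_geq // subrr.
  rewrite addnS big_nat_recr ?leq_addr //= IH [2^-1 ^+ (m + d).+1]exprS [2 * (_ * _)]mulrA.
  rewrite divff ?pnatr_eq0 // mul1r -addrA; congr (_ + _).
  by rewrite mulr_natl mulr2n opprD subrK.
rewrite -(subnKC (ltnW mn)) H gerBl mulr_ge0 // exprn_ge0 //; exact: half_ge0.
Qed.

Lemma normed_lim_le (F : normedModType K) (u : nat -> F) l (M : K) :
  u @ \oo --> l -> (\forall n \near \oo, `|u n| <= M) -> `|l| <= M.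
Proof.
move=> ul uM; apply/ler_addgt0Pl => e e0.
have /cvgrPdist_le/(_ e e0) H := ul.
near \oo => n.
rewrite -(subrK (u n) l); apply: le_trans (ler_normD _ _) _.
by apply: lerD; near: n.
Unshelve. all: by end_near. Qed.

Lemma series_norm_le (F : normedModType K) (u : nat -> F) (M : K) N :
  0 <= M -> (forall n, `|u n| <= M * 2^-1 ^+ n) -> `|series u N| <= M * 2.
Proof.
move=> M0 uM; rewrite /series /=; apply: le_trans (ler_norm_sum _ _ _) _.
apply: (@le_trans _ _ (\sum_(0 <= i < N) M * 2^-1 ^+ i)).
  by apply: ler_sum => i _; exact: uM.
by rewrite -mulr_sumr ler_wpM2l //; have := geo_tail 0 N; rewrite expr0 mulr1.
Qed.

Lemma geo_cvg (F : completeNormedModType K) (u : nat -> F) (M : K) :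
  0 <= M -> (forall n, `|u n| <= M * 2^-1 ^+ n) -> cvg (series u @ \oo).
Proof.
move=> M0 uM; apply/cauchy_cvgP/cauchy_seriesP => e e0.
have [N HN] : exists N, (M + 1) * 2 * 2^-1 ^+ N < e.
  have M1 : 0 < (M + 1) * 2 by rewrite mulr_gt0 // ltr_wpDl.
  have [N HN] := archiK (divr_gt0 e0 M1); exists N.
  by rewrite mulrC -ltr_pdivlMr.
exists ([set n | N <= n]%N, setT) => /=.
  by split; [exists N|exact: filterT].
move=> [m n] [/= Nm _]; apply: le_lt_trans HN.
apply: le_trans (ler_norm_sum _ _ _) _.
apply: (@le_trans _ _ (\sum_(m <= i < n) M * 2^-1 ^+ i)).
  by apply: ler_sum => i _; exact: uM.
rewrite -mulr_sumr -mulrA; apply: ler_pM => //.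
- by apply: sumr_ge0 => i _; rewrite exprn_ge0 // half_ge0.
- by rewrite lerDl.
- apply: le_trans (geo_tail _ _) _; rewrite ler_wpM2l //.
  by rewrite ler_wiXn2l // ?half_ge0 // invf_le1 // ler1n.
Qed.

Lemma lin_bound_cont (E F : normedModType K) (L : {linear E -> F}) (M : K) :
  0 <= M -> (forall k, `|L k| <= M * `|k|) -> continuous L.
Proof.
move=> M0 LM; apply: bounded_linear_continuous; apply/bounded_funP => r.
exists (M * r) => x xr; apply: le_trans (LM x) _; exact: ler_wpM2l.
Qed.

Lemma analytic_derivative (E F : completeNormedModType K) (f : E -> F) (x : E)
    (a : forall n, ('I_n -> E) -> F) (C r : K) :
  0 < r -> (forall n, multilinear (a n)) ->
  (forall n, mbound (a n) (C * r^-1 ^+ n)) ->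
  (forall h, `|h| < r -> series (fun n => a n (fun=> h)) @ \oo --> f (x + h)) ->
  forall h, `|h| <= r / 4 -> differentiable f (x + h) /\
    forall k, series (fun n => Der (a n) h k) @ \oo --> 'd f (x + h) k.
Proof.
move=> r0 ma ba fa h hr.
have C0 : 0 <= C.
  have := ba 0%N (fun=> 0); rewrite big_ord0 expr0 !mulr1.
  by apply: le_trans.
have s0 : 0 < r / 4 by rewrite divr_gt0.
set s := r / 4 in hr s0.
have As n : C * r^-1 ^+ n * 2 ^+ n * s ^+ n = C * 2^-1 ^+ n.
  rewrite -!mulrA -!exprMn; congr (_ * _ ^+ _).
  by rewrite /s; field; rewrite gt_eqF.
have A0 n : 0 <= C * r^-1 ^+ n by rewrite mulr_ge0 // exprn_ge0 // invr_ge0 ltW.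
have Db n k : `|Der (a n) h k| <= C * (`|k| / s) * 2^-1 ^+ n.
  have ks : `|k| <= s * (`|k| / s) by rewrite mulrCA divff ?mulr1 // gt_eqF.
  have u0 : 0 <= `|k| / s by rewrite divr_ge0 // ltW.
  have := Der_bound (ltW s0) u0 hr ks (A0 n) (ba n).
  by rewrite As mulrAC.
have Dcv k : cvg (series (fun n => Der (a n) h k) @ \oo).
  apply: (geo_cvg (M := C * (`|k| / s))) => //.
  by rewrite mulr_ge0 // divr_ge0 // ltW.
pose L k := lim (series (fun n => Der (a n) h k) @ \oo).
have Llin : linear L.
  move=> c k k'; rewrite /L; apply: cvg_lim => //.
  have -> : series (fun n => Der (a n) h (c *: k + k')) =
     (c *: series (fun n => Der (a n) h k)) + series (fun n => Der (a n) h k').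
    apply/funext => N; rewrite !fctE /series /= scaler_sumr -big_split /=.
    by apply: eq_bigr => i _; rewrite DerD.
  by apply: cvgD; [apply: cvgZl_tmp; exact: Dcv|exact: Dcv].
have Lb k : `|L k| <= C * (`|k| / s) * 2.
  apply: normed_lim_le (Dcv k) _; apply: nearW => N.
  apply: series_norm_le => //.
  by rewrite mulr_ge0 // divr_ge0 // ltW.
pose LM := GRing.isLinear.Build _ _ _ _ _ Llin.
pose LL : {linear E -> F} := HB.pack L LM.
have cL : continuous LL.
  apply: (lin_bound_cont (M := C / s * 2)); first by rewrite !mulr_ge0 // invr_ge0 ltW.
  move=> k; apply: le_trans (Lb k) _.
  by rewrite le_eqVlt; apply/orP; left; apply/eqP; ring.
suff : differentiable f (x + h) /\ 'd f (x + h) = LL :> (E -> F).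
  by move=> [df ->]; split => // k; exact: Dcv.
apply: diffP_eps => // e e0.
have C1 : 0 < C * 2 + 1 by rewrite ltr_wpDl // mulr_ge0.
near=> k.
have ks : `|k| <= s by near: k; exact: nbhs0_le.
have u0 : 0 <= `|k| / s by rewrite divr_ge0 // ltW.
have u1 : `|k| / s <= 1 by rewrite ler_pdivrMr // mul1r.
have ks' : `|k| <= s * (`|k| / s) by rewrite mulrCA divff ?mulr1 // gt_eqF.
have rE : s + s + s + s = r by rewrite /s; field.
have hkr : `|h + k| < r.
  apply: le_lt_trans (ler_normD _ _) _; rewrite -rE.
  apply: le_lt_trans (lerD hr ks) _.
  by rewrite -addrA ltrDl addr_gt0.
have hr' : `|h| < r.
  by apply: le_lt_trans hr _; rewrite -rE -!addrA ltrDl !addr_gt0.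
apply: (@le_trans _ _ (C * (`|k| / s) ^+ 2 * 2)); last first.
  have : `|k| <= e * s ^+ 2 / (C * 2 + 1).
    by near: k; apply: nbhs0_le; exact: divr_gt0 (mulr_gt0 e0 (exprn_gt0 2 s0)) C1.
  rewrite ler_pdivlMr // => H.
  rewrite (_ : _ * 2 = `|k| * (C * 2) / s ^+ 2 * `|k|); last first.
    by field; rewrite gt_eqF.
  rewrite ler_wpM2r // ler_pdivrMr ?exprn_gt0 //.
  by apply: le_trans H; rewrite ler_wpM2l // lerDl.
have -> : k + (x + h) = x + (h + k) by rewrite addrC addrA.
have cv : series (fun n => a n (fun=> h + k)) - series (fun n => a n (fun=> h))
    - series (fun n => Der (a n) h k) @ \oo --> f (x + (h + k)) - f (x + h) - LL k.
  by apply: cvgB; [apply: cvgB; exact: fa|exact: Dcv].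
apply: normed_lim_le cv _; apply: nearW => N.
have -> : (series (fun n => a n (fun=> h + k)) - series (fun n => a n (fun=> h))
    - series (fun n => Der (a n) h k)) N =
    series (fun n => a n (fun=> h + k) - a n (fun=> h) - Der (a n) h k) N.
  by rewrite !fctE /series /= !sumrB.
apply: series_norm_le; first by rewrite mulr_ge0 // exprn_ge0.
move=> n; have := taylor2 (ltW s0) u0 hr ks' u1 (A0 n) (ma n) (ba n).
by rewrite As mulrAC.
Unshelve. all: by end_near. Qed.
Lemma analytic_differentiable (E F : completeNormedModType K) (f : E -> F) x :
  analytic_at f x -> differentiable f x.
Proof.
move=> [a [C [r [r0 ma ba fa]]]].
have h0 : `|0 : E| <= r / 4 by rewrite normr0 divr_ge0 // ltW.
have [+ _] := analytic_derivative r0 ma ba fa h0.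
by rewrite addr0.
Qed.

Lemma analytic_ext (E F : normedModType K) (U : set E) (f g : E -> F) :
  open U -> (forall x, U x -> f x = g x) -> analytic_on U f -> analytic_on U g.
Proof.
move=> oU fg af x Ux; have [a [C [r [r0 ma ba fa]]]] := af x Ux.
have /nbhs_ballP[d d0 dU] := open_nbhs_nbhs (conj oU Ux).
have C0 : 0 <= C.
  have := ba 0%N (fun=> 0); rewrite big_ord0 expr0 !mulr1.
  by apply: le_trans.
pose r' := (r^-1 + d^-1)^-1.
have s0 : 0 < r^-1 + d^-1 by rewrite addr_gt0 // invr_gt0.
have r'0 : 0 < r' by rewrite invr_gt0.
have r'r : r' <= r.
  by rewrite -[leRHS]invrK lef_pV2 ?posrE ?invr_gt0 // lerDl invr_ge0 ltW.
have r'd : r' <= d.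
  by rewrite -[leRHS]invrK lef_pV2 ?posrE ?invr_gt0 // lerDr invr_ge0 ltW.
exists a, C, r'; split => //.
  move=> n v; apply: le_trans (ba n v) _.
  rewrite ler_wpM2r ?prodr_ge0 // ler_wpM2l // invrK.
  by rewrite lerXn2r // ?nnegrE ?invr_ge0 ?(ltW r0) ?(ltW s0) // lerDl invr_ge0 ltW.
move=> h hr'; rewrite -fg; first by apply: fa; apply: lt_le_trans hr' _.
apply: dU; rewrite -ball_normE /ball_ /= opprD addrA subrr sub0r normrN.
exact: lt_le_trans hr' _.
Qed.

Lemma analytic_sub (E F : normedModType K) (U V : set E) (f : E -> F) :
  V `<=` U -> analytic_on U f -> analytic_on V f.
Proof. by move=> VU af x /VU /af. Qed.

Lemma analytic_linear (E F : normedModType K) (U : set E) (L : {linear E -> F}) :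
  continuous L -> analytic_on U L.
Proof.
move=> /linear_lipschitz [k k0 Lk] x _.
pose a n : ('I_n -> E) -> F := match n return ('I_n -> E) -> F with
  | 0 => fun=> L x | 1 => fun v => L (v ord0) | _ => fun=> 0 end.
exists a, (`|L x| + k), 1; split => //.
- case=> [|[|n]] i v c y z /=; first by case: i.
    by rewrite /upd !ord1 eqxx linearP.
  by rewrite scaler0 addr0.
- case=> [|[|n]] v; rewrite invr1 expr1n mulr1 /=.
  + by rewrite big_ord0 mulr1 lerDl ltW.
  + rewrite big_ord1; apply: le_trans (Lk _) _.
    by rewrite ler_wpM2r // lerDr.
  + by rewrite normr0 mulr_ge0 ?prodr_ge0 // addr_ge0 // ltW.
move=> h _; apply: cvg_near_cst; near=> n.
have n2 : (1 < n)%N by near: n; exists 2%N.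
have [m ->] : exists m, n = m.+2 by exists n.-2; lia.
rewrite /series /= big_nat_recl // big_nat_recl //= big1_seq ?addr0 ?linearD //.
Unshelve. all: by end_near. Qed.

Lemma multilinearD (E F : normedModType K) n (a b : ('I_n -> E) -> F) :
  multilinear a -> multilinear b -> multilinear (fun v => a v + b v).
Proof.
by move=> ma mb i v c x y; rewrite ma mb scalerDr addrACA.
Qed.

Lemma multilinear_sum (E F : normedModType K) n m
    (a : 'I_m -> ('I_n -> E) -> F) :
  (forall i, multilinear (a i)) -> multilinear (fun v => \sum_i a i v).
Proof.
move=> ma i v c x y; rewrite scaler_sumr -big_split; apply: eq_bigr => j _.
exact: ma.
Qed.

Lemma multilinear_pair (E F G : normedModType K) n (a : ('I_n -> E) -> F)
    (b : ('I_n -> E) -> G) :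
  multilinear a -> multilinear b -> multilinear (fun v => (a v, b v)).
Proof. by move=> ma mb i v c x y; rewrite ma mb. Qed.

Lemma fst_upd (E G : Type) n (q : 'I_n -> E * G) i z :
  fst \o upd q i z = upd (fst \o q) i z.1.
Proof. by apply/funext => j; rewrite /upd /=; case: eqP. Qed.

Lemma multilinear_fst (E G F : normedModType K) n (a : ('I_n -> E) -> F) :
  multilinear a -> multilinear (fun q : 'I_n -> (E * G)%type => a (fst \o q)).
Proof. by move=> ma i v c x y; rewrite !fst_upd ma. Qed.

Lemma fins_upd (T : Type) n (i : 'I_n.+1) (x y : T) (v : 'I_n -> T) l :
  fins i x (upd v l y) = upd (fins i x v) (lift i l) y.
Proof.
apply/funext => j; rewrite /fins /upd.
case: (unliftP i j) => [j' ->|->] /=; last by rewrite (negPf (neq_lift i l)).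
by rewrite (inj_eq lift_inj).
Qed.

Lemma fins_const (T : Type) n (i : 'I_n.+1) (x y : T) :
  fins i x (fun=> y) = upd (fun=> y) i x.
Proof.
apply/funext => j; rewrite /fins /upd.
case: (unliftP i j) => [j' ->|->] /=; last by rewrite eqxx.
by rewrite eq_sym (negPf (neq_lift i j')).
Qed.

Lemma multilinear_fins (E F : normedModType K) n (a : ('I_n.+1 -> E) -> F) i x :
  multilinear a -> multilinear (fun v => a (fins i x v)).
Proof. by move=> ma l v c y z; rewrite !fins_upd ma. Qed.

Lemma multilinear_upd (E F : normedModType K) n (a : ('I_n -> E) -> F) i :
  multilinear a ->
  multilinear (fun q : 'I_n -> (E * E)%type => a (upd (fst \o q) i (q i).2)).
Proof.
move=> ma l q c y z; rewrite !fst_upd.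
have [->|li] := eqVneq l i.
  have H w : upd (upd (fst \o q) i w.1) i (upd q i w i).2 = upd (fst \o q) i w.2.
    by apply/funext => j; rewrite /upd eqxx; case: eqP.
  by rewrite !H ma.
have H (w : (E * E)%type) : upd (upd (fst \o q) l w.1) i (upd q l w i).2 =
    upd (upd (fst \o q) i (q i).2) l w.1.
  apply/funext => j; rewrite /upd; have [->|ji] := eqVneq j i.
    by rewrite eq_sym (negPf li).
  by [].
by rewrite !H ma.
Qed.

Lemma norm_fst (E G : normedModType K) (p : (E * G)%type) : `|p.1| <= `|p|.
Proof. by rewrite prod_normE num_le_max lexx. Qed.

Lemma norm_snd (E G : normedModType K) (p : (E * G)%type) : `|p.2| <= `|p|.
Proof. by rewrite prod_normE num_le_max lexx orbT. Qed.

Lemma ler_norm_pair (E G : normedModType K) (x : E) (y : G) (M : K) :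
  `|x| <= M -> `|y| <= M -> `|(x, y)| <= M.
Proof. by move=> ? ?; rewrite prod_normE num_ge_max; apply/andP. Qed.

Lemma ltS_exp4 n : (n.+1%:R <= 4 ^+ n :> K).
Proof.
rewrite -natrX ler_nat; elim: n => // n IH; rewrite expnS.
by apply: leq_trans (leq_mul (leqnn 4) IH); lia.
Qed.

Lemma analytic_tangent (E F : completeNormedModType K) (U : set E) (f : E -> F) :
  analytic_on U f -> analytic_on (U `*` setT) (tangent_fun f).
Proof.
move=> af [x v0] [/= /af [a [C [r [r0 ma ba fa]]]] _].
have C0 : 0 <= C.
  have := ba 0%N (fun=> 0); rewrite big_ord0 expr0 !mulr1.
  by apply: le_trans.
pose b1 n (q : 'I_n -> E * E) := a n (fst \o q).
pose b2 n (q : 'I_n -> E * E) := \sum_(i < n.+1) a n.+1 (fins i v0 (fst \o q)).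
pose b3 n (q : 'I_n -> E * E) := \sum_(i < n) a n (upd (fst \o q) i (q i).2).
pose b n (q : 'I_n -> E * E) : F * F := (b1 n q, b2 n q + b3 n q).
have s0 : 0 < r / 4 by rewrite divr_gt0.
exists b, (C * (1 + `|v0| / r)), (r / 4); split => //.
- move=> n; apply: multilinear_pair; first exact: multilinear_fst.
  apply: multilinearD; apply: multilinear_sum => i.
    exact: (multilinear_fst (multilinear_fins _ _ (ma _))).
  exact: multilinear_upd.
- move=> n q; set P := \prod_(i < n) `|q i|.
  have P0 : 0 <= P by rewrite prodr_ge0.
  have p1 : \prod_(i < n) `|(fst \o q) i| <= P.
    by apply: ler_prod => i _; rewrite normr_ge0 norm_fst.
  have rn0 : 0 <= r^-1 ^+ n by rewrite exprn_ge0 // invr_ge0 ltW.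
  have B1 : `|b1 n q| <= C * r^-1 ^+ n * P.
    by apply: le_trans (ba _ _) _; rewrite ler_wpM2l // mulr_ge0.
  have B2 : `|b2 n q| <= n.+1%:R * (C * r^-1 ^+ n * (`|v0| / r) * P).
    apply: le_trans (ler_norm_sum _ _ _) _.
    rewrite mulr_natl -[X in _ *+ X](card_ord n.+1) -sumr_const.
    apply: ler_sum => i _; apply: le_trans (ba _ _) _.
    rewrite (bigD1_ord i) //= {1}/fins unlift_none /=.
    under eq_bigr do rewrite /fins liftK /=.
    rewrite exprS [leRHS](_ : _ = C * (r^-1 * r^-1 ^+ n) * (`|v0| * P)); last by ring.
    apply: ler_wpM2l; last exact: ler_wpM2l.
    by rewrite !mulr_ge0 // invr_ge0 ltW.
  have B3 : `|b3 n q| <= n%:R * (C * r^-1 ^+ n * P).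
    apply: le_trans (ler_norm_sum _ _ _) _.
    rewrite mulr_natl -[X in _ *+ X](card_ord n) -sumr_const.
    apply: ler_sum => i _; apply: le_trans (ba _ _) _.
    rewrite ler_wpM2l ?mulr_ge0 //; apply: ler_prod => j _; rewrite normr_ge0 /=.
    by rewrite /upd; case: eqP => [->|_]; [exact: norm_snd|exact: norm_fst].
  have X0 : 0 <= C * r^-1 ^+ n * P by rewrite !mulr_ge0.
  have w0 : 0 <= `|v0| / r by rewrite divr_ge0 // ltW.
  have key : n.+1%:R * (C * r^-1 ^+ n * (1 + `|v0| / r) * P) <=
      C * (1 + `|v0| / r) * (r / 4)^-1 ^+ n * P.
    rewrite mulrA ler_wpM2r // invfM invrK exprMn.
    rewrite (_ : n.+1%:R * _ = C * (1 + `|v0| / r) * (r^-1 ^+ n * n.+1%:R)); last by ring.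
    rewrite ler_wpM2l ?mulr_ge0 ?addr_ge0 // ler_wpM2l //; exact: ltS_exp4.
  apply: ler_norm_pair; apply: le_trans key.
    apply: le_trans B1 _.
    rewrite [leRHS](_ : _ = n.+1%:R * (1 + `|v0| / r) * (C * r^-1 ^+ n * P)); last by ring.
    by rewrite ler_peMl // mulr_ege1 // ?ler1n // lerDl.
  apply: le_trans (ler_normD _ _) _; apply: le_trans (lerD B2 B3) _.
  have -> : n.+1%:R * (C * r^-1 ^+ n * (1 + `|v0| / r) * P) =
    n.+1%:R * (C * r^-1 ^+ n * (`|v0| / r) * P) + n.+1%:R * (C * r^-1 ^+ n * P) :> K by ring.
  by rewrite lerD2l ler_wpM2r // ler_nat.
move=> [h k] hk.
have hr : `|h| <= r / 4 by apply/ltW; apply: le_lt_trans hk; exact: (norm_fst (h, k)).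
have [df cv] := analytic_derivative r0 ma ba fa hr.
have hr' : `|h| < r.
  apply: le_lt_trans hr _; rewrite ltr_pdivrMr // ltr_pMr //.
  by rewrite (ltr_nat _ 1).
have -> : series (fun n => b n (fun=> (h, k))) = (fun N =>
    (series (fun n => a n (fun=> h)) N,
     series (fun n => Der (a n) h v0) N.+1 + series (fun n => Der (a n) h k) N)).
  apply/funext => N; rewrite /series /= big_nat_recl // [Der (a 0%N) _ _]big_ord0 add0r.
  rewrite -big_split /=; elim: N => [|N IH]; first by rewrite !big_geq.
  rewrite big_nat_recr //= IH !big_nat_recr //=; congr (_, _); congr (_ + _).
  rewrite /b2 /b3 /Der; congr (_ + _); apply: eq_bigr => i _ //.
  by rewrite -fins_const.
rewrite /tangent_fun /=; apply: cvg_pair; first exact: fa.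
rewrite linearD; apply: cvgD; last exact: cv.
by rewrite (cvg_shiftS (series (fun n => Der (a n) h v0))); exact: cv.
Qed.

End Analytic.
Variant scalar_kind := RealScalars | ComplexScalars.

Definition scalar (R : realType) (k : scalar_kind) : numFieldType :=
  match k with RealScalars => R | ComplexScalars => R[i]%C end.

Lemma archi_scalar (R : realType) (k : scalar_kind) : archi (scalar R k).
Proof.
have H (e : R) : 0 < e -> exists n, 2^-1 ^+ n < e.
  move=> e0; exists (Num.bound e^-1).
  have b := archi_boundP (ltW (eq_ind_r is_true e0 (invr_gt0 e))).
  rewrite exprVn invf_plt ?posrE // ?exprn_gt0 //; apply: lt_le_trans b _.
  by rewrite -natrX ler_nat ltnW // ltn_expl.
case: k => [|[a b]] /=; first exact: H.
rewrite ltcE /= => /andP[/eqP b0 /H[n Hn]]; exists n.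
have -> : (2^-1 ^+ n : R[i]%C) = ((2^-1 ^+ n)%:C)%C.
  by rewrite rmorphXn /= fmorphV rmorph_nat.
by rewrite ltcE /= b0 eqxx.
Qed.

Arguments archi_scalar : clear implicits.

Variant regularity := Smooth | Analytic.

Definition regular_on (r : regularity) (K : numFieldType)
    (E F : normedModType K) (U : set E) (f : E -> F) :=
  match r with Smooth => smooth_on U f | Analytic => analytic_on U f end.

(* A manifold is a set with an atlas; the charts [chart i : dom i -> model i] *)
(* take values in Banach spaces which may depend on the chart, and no         *)
(* separation or countability condition is imposed. The carrier has the       *)
(* topology for which the charts are homeomorphisms onto open sets. The       *)
(* values of [chart i] outside [dom i], and those of [chart_inv i] outside    *)
(* the image of [dom i], are irrelevant.                                      *)
Record manifold (R : realType) (k : scalar_kind) (r : regularity) := Manifold {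
  carrier :> Type;
  chart_index : Type;
  model : chart_index -> completeNormedModType (scalar R k);
  dom : chart_index -> set carrier;
  chart : forall i, carrier -> model i;
  chart_inv : forall i, model i -> carrier;
  dom_cover : forall x, exists i, dom i x;
  chartK : forall i x, dom i x -> chart_inv (chart i x) = x;
  open_overlap : forall i j, open (chart i @` (dom i `&` dom j));
  regular_transition : forall i j,
    regular_on r (chart i @` (dom i `&` dom j)) (chart j \o @chart_inv i)
}.

Arguments chart_index {R k r} _.
Arguments model {R k r} M _ : rename.
Arguments dom {R k r M} _ _ : rename.
Arguments chart {R k r M} _ _ : rename.
Arguments chart_inv {R k r M} _ _ : rename.
Arguments dom_cover {R k r M} _ : rename.
Arguments chartK {R k r M i x} _ : rename.
Arguments open_overlap {R k r M} _ _ : rename.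
Arguments regular_transition {R k r M} _ _ : rename.

Section Regular.
Context (R : realType) (k : scalar_kind) (r : regularity).
Local Notation K := (scalar R k).
Implicit Types E F : completeNormedModType K.

Lemma regular_diff E F (U : set E) (f : E -> F) x :
  regular_on r U f -> U x -> differentiable f x.
Proof.
case: r => [sf Ux|af /af]; first exact: (Ck_diff (sf 1%N)).
exact: (analytic_differentiable (archi_scalar R k)).
Qed.

Lemma regular_ext E F (U : set E) (f g : E -> F) : open U ->
  (forall x, U x -> f x = g x) -> regular_on r U f -> regular_on r U g.
Proof.
by move=> oU fg; case: r => [sf n|]; [exact: Ck_ext (sf n)|exact: analytic_ext].
Qed.

Lemma regular_sub E F (U V : set E) (f : E -> F) :
  V `<=` U -> regular_on r U f -> regular_on r V f.
Proof.
by move=> VU; case: r => [sf n|]; [exact: Ck_sub (sf n)|exact: analytic_sub].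
Qed.

Lemma regular_tangent E F (U : set E) (f : E -> F) : open U ->
  regular_on r U f -> regular_on r (U `*` setT) (tangent_fun f).
Proof.
move=> oU; case: r; first exact: smooth_tangent.
exact: (analytic_tangent (archi_scalar R k)).
Qed.

Lemma regular_linear E F (U : set E) (L : {linear E -> F}) :
  open U -> continuous L -> regular_on r U L.
Proof.
by move=> oU cL; case: r; [exact: smooth_linear|exact: analytic_linear].
Qed.

End Regular.

Section Manifolds.
Context {R : realType} {k : scalar_kind} {r : regularity}.
Local Notation manifold := (manifold R k r).
Implicit Types M N : manifold.

Definition rep M N (f : M -> N) (i : chart_index M) (j : chart_index N) :
  model M i -> model N j := chart j \o f \o chart_inv i.

Definition trans M (i j : chart_index M) : model M i -> model M j :=
  chart j \o chart_inv i.

Arguments rep {M N} f i j _.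
Arguments trans {M} i j _.

(* [f] is a morphism if, around each point, it maps the domain of some chart  *)
(* (here, a restriction of [i] to an open subset) into the domain of a chart  *)
(* [j] and its local representative is of the required class.                 *)
Definition is_morphism M N (f : M -> N) := forall x, exists i j,
  exists W : set (model M i),
  [/\ dom i x /\ dom j (f x), open W, W (chart i x),
      W `<=` chart i @` (dom i `&` f @^-1` dom j) & regular_on r W (rep f i j)].

Record hom M N := Hom { hom_fun :> M -> N; homP : is_morphism hom_fun }.

Lemma hom_eq M N (f g : hom M N) : f =1 g -> f = g.
Proof.
case: f g => [f hf] [g hg] /= /funext fg; rewrite -fg in hg *.
by congr Hom; exact: Prop_irrelevance.
Qed.

Lemma trans_diff M (i j : chart_index M) x : dom i x -> dom j x ->
  differentiable (trans i j) (chart i x).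
Proof.
by move=> ix jx; apply: (regular_diff (regular_transition i j)); exists x.
Qed.

Lemma near_overlap M (i j : chart_index M) x : dom i x -> dom j x ->
  \forall y \near chart i x, (chart i @` (dom i `&` dom j)) y.
Proof.
move=> ix jx; apply: open_nbhs_nbhs; split; first exact: open_overlap.
by exists x.
Qed.

Lemma trans_chart M (i j : chart_index M) x : dom i x ->
  trans i j (chart i x) = chart j x.
Proof. by move=> ix; rewrite /trans /= chartK. Qed.

Lemma rep_chart M N (f : M -> N) (i : chart_index M) (j : chart_index N) x :
  dom i x -> rep f i j (chart i x) = chart j (f x).
Proof. by move=> ix; rewrite /rep /= chartK. Qed.

Lemma near_rep M N (f : hom M N) (i : chart_index M) (j : chart_index N) x :
  dom i x -> dom j (f x) ->
  \forall y \near chart i x, (chart i @` (dom i `&` f @^-1` dom j)) y.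
Proof.
move=> ix jfx; have [i' [j' [W [[i'x j'fx] oW Wx WD rW]]]] := homP f x.
have ct : {for chart i x, continuous (trans i i')}.
  exact/differentiable_continuous/trans_diff.
have cr : {for chart i x, continuous (rep f i' j' \o trans i i')}.
  apply: continuous_comp => //; rewrite trans_chart //.
  exact/differentiable_continuous/(regular_diff rW).
have n1 : \forall y \near chart i x, W (trans i i' y).
  by apply: ct; apply: open_nbhs_nbhs; split => //; rewrite trans_chart.
have n2 : \forall y \near chart i x,
    (chart j' @` (dom j' `&` dom j)) (rep f i' j' (trans i i' y)).
  apply: cr; apply: open_nbhs_nbhs; split; first exact: open_overlap.
  by rewrite /= trans_chart // rep_chart //; exists (f x).
near=> y.
have [z [iz i'z] zy] : (chart i @` (dom i `&` dom i')) y.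
  by near: y; exact: near_overlap.
have : (chart j' @` (dom j' `&` dom j)) (rep f i' j' (trans i i' y)) by near: y.
have : W (trans i i' y) by near: y.
rewrite -zy trans_chart // => /WD[z' [i'z' j'fz'] z'z].
have {}z'z : z' = z by rewrite -(chartK i'z') z'z chartK.
rewrite z'z in j'fz'; rewrite rep_chart // => -[w [j'w jw] wz].
have wfz : w = f z by rewrite -(chartK j'w) wz chartK.
by exists z => //; split => //; rewrite /= -wfz.
Unshelve. all: by end_near. Qed.

Lemma rep_diff M N (f : hom M N) (i : chart_index M) (j : chart_index N) x :
  dom i x -> dom j (f x) -> differentiable (rep f i j) (chart i x).
Proof.
move=> ix jfx; have [i' [j' [W [[i'x j'fx] oW Wx WD rW]]]] := homP f x.
suff : differentiable (trans j' j \o (rep f i' j' \o trans i i')) (chart i x).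
  move=> dg; apply: (proj1 (diff_near _ dg)); near=> y.
  have [z [iz i'z] zy] : (chart i @` (dom i `&` dom i')) y.
    by near: y; exact: near_overlap.
  have [z' [iz' j'z'] z'y] : (chart i @` (dom i `&` f @^-1` dom j')) y.
    by near: y; exact: near_rep.
  have z'z : z' = z by rewrite -(chartK iz') z'y -zy chartK.
  rewrite z'z in j'z'.
  by rewrite -zy /= trans_chart // rep_chart // trans_chart // rep_chart.
apply: differentiable_comp; last first.
  by rewrite /= trans_chart // rep_chart //; exact: trans_diff.
apply: differentiable_comp; first exact: trans_diff.
by rewrite trans_chart //; exact: (regular_diff rW).
Unshelve. all: by end_near. Qed.

Lemma diff_trans_comp M (i j l : chart_index M) x w :
  dom i x -> dom j x -> dom l x ->
  'd (trans j l) (chart j x) ('d (trans i j) (chart i x) w) =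
  'd (trans i l) (chart i x) w.
Proof.
move=> ix jx lx.
have d1 := trans_diff ix jx; have d2 := trans_diff jx lx.
have d2' : differentiable (trans j l) (trans i j (chart i x)).
  by rewrite trans_chart.
have d3 := differentiable_comp d1 d2'.
have [_ ->] : differentiable (trans i l) (chart i x) /\
  'd (trans i l) (chart i x) = 'd (trans j l \o trans i j) (chart i x) :> (_ -> _).
  apply: diff_near => //; near=> y.
  have [z [iz jz] <-] : (chart i @` (dom i `&` dom j)) y.
    by near: y; exact: near_overlap.
  by rewrite /= !trans_chart.
by rewrite diff_comp //= trans_chart.
Unshelve. all: by end_near. Qed.

Lemma diff_trans_id M (i : chart_index M) x w : dom i x ->
  'd (trans i i) (chart i x) w = w.
Proof.
move=> ix.
have [_ ->] : differentiable (trans i i) (chart i x) /\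
  'd (trans i i) (chart i x) = 'd (@idfun (model M i)) (chart i x) :> (_ -> _).
  apply: diff_near; last exact: (@ex_diff _ _ _ _ _ _ id).
  near=> y.
  have [z [iz _] <-] : (chart i @` (dom i `&` dom i)) y.
    by near: y; exact: near_overlap.
  by rewrite /= trans_chart.
by rewrite (@diff_val _ _ _ _ _ _ id).
Unshelve. all: by end_near. Qed.

Lemma diff_rep_trans M N (f : hom M N) (i i' : chart_index M)
    (j : chart_index N) x w : dom i x -> dom i' x -> dom j (f x) ->
  'd (rep f i' j) (chart i' x) ('d (trans i i') (chart i x) w) =
  'd (rep f i j) (chart i x) w.
Proof.
move=> ix i'x jx.
have d1 := trans_diff ix i'x; have d2 := rep_diff i'x jx.
have d2' : differentiable (rep f i' j) (trans i i' (chart i x)).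
  by rewrite trans_chart.
have d3 := differentiable_comp d1 d2'.
have [_ ->] : differentiable (rep f i j) (chart i x) /\
  'd (rep f i j) (chart i x) = 'd (rep f i' j \o trans i i') (chart i x) :> (_ -> _).
  apply: diff_near => //; near=> y.
  have [z [iz i'z] <-] : (chart i @` (dom i `&` dom i')) y.
    by near: y; exact: near_overlap.
  by rewrite /= trans_chart // !rep_chart.
by rewrite diff_comp //= trans_chart.
Unshelve. all: by end_near. Qed.

Lemma diff_trans_rep M N (f : hom M N) (i : chart_index M)
    (j j' : chart_index N) x w : dom i x -> dom j (f x) -> dom j' (f x) ->
  'd (trans j j') (chart j (f x)) ('d (rep f i j) (chart i x) w) =
  'd (rep f i j') (chart i x) w.
Proof.
move=> ix jx j'x.
have d1 := rep_diff ix jx; have d2 := trans_diff jx j'x.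
have d2' : differentiable (trans j j') (rep f i j (chart i x)).
  by rewrite rep_chart.
have d3 := differentiable_comp d1 d2'.
have [_ ->] : differentiable (rep f i j') (chart i x) /\
  'd (rep f i j') (chart i x) = 'd (trans j j' \o rep f i j) (chart i x) :> (_ -> _).
  apply: diff_near => //; near=> y.
  have [z [iz jz] <-] : (chart i @` (dom i `&` f @^-1` dom j)) y.
    by near: y; exact: near_rep.
  by rewrite /= !rep_chart // trans_chart.
by rewrite diff_comp //= rep_chart.
Unshelve. all: by end_near. Qed.

(* A tangent vector at [base] is a family of vectors of the model spaces, one *)
(* for each chart around [base], related by the differentials of the changes  *)
(* of charts. The components in the other charts are set to 0.                *)
Record tangent_vector M := TangentVector {
  base : M;
  coord : forall i, model M i;
  coord_out : forall i, ~ dom i base -> coord i = 0;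
  coord_change : forall i j, dom i base -> dom j base ->
    coord j = 'd (trans i j) (chart i base) (coord i)
}.

Lemma tangent_vector_eq M (p q : tangent_vector M) :
  base p = base q -> (forall i, dom i (base p) -> coord p i = coord q i) -> p = q.
Proof.
case: p q => [x v v0 vc] [y w w0 wc] /= xy vw.
move: w0 wc; rewrite -xy => w0 wc {y xy}.
have vw' : v = w.
  apply: functional_extensionality_dep => i; have [/vw//|ix] := pselect (dom i x).
  by rewrite v0 // w0.
move: w0 wc; rewrite -vw' => w0 wc; congr TangentVector; exact: Prop_irrelevance.
Qed.

Section VectorAt.
Context M (i : chart_index M) (x : M) (w : model M i).

Definition vector_at_coord (j : chart_index M) : model M j :=
  if pselect (dom i x /\ dom j x) then 'd (trans i j) (chart i x) w else 0.

Fact vector_at_out j : ~ dom j x -> vector_at_coord j = 0.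
Proof. by rewrite /vector_at_coord; case: pselect => // -[]. Qed.

Fact vector_at_change j l : dom j x -> dom l x ->
  vector_at_coord l = 'd (trans j l) (chart j x) (vector_at_coord j).
Proof.
move=> jx lx; rewrite /vector_at_coord.
have [ix|nix] := pselect (dom i x); last first.
  case: (pselect (dom i x /\ dom l x)) => [[ix lx']|nl] /=; first by [].
  case: (pselect (dom i x /\ dom j x)) => [[ix jx']|nj] /=; first by [].
  by rewrite linear0.
case: (pselect (dom i x /\ dom l x)) => [il|nl] /=; last by case: nl.
case: (pselect (dom i x /\ dom j x)) => [ij|nj] /=; last by case: nj.
by rewrite diff_trans_comp.
Qed.

(* The tangent vector at [x] whose component in the chart [i] is [w]; this is *)
(* the zero vector if [i] is not a chart around [x].                          *)
Definition vector_at : tangent_vector M :=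
  TangentVector vector_at_out vector_at_change.

Lemma vector_at_coordE j : dom i x -> dom j x ->
  coord vector_at j = 'd (trans i j) (chart i x) w.
Proof. by move=> ix jx; rewrite /= /vector_at_coord; case: pselect => // -[]. Qed.

End VectorAt.

Lemma vector_atK M (i : chart_index M) (p : tangent_vector M) :
  dom i (base p) -> vector_at (base p) (coord p i) = p.
Proof.
move=> ip; apply: tangent_vector_eq => //= j jp.
by rewrite -[LHS]/(coord (vector_at _ _) j) vector_at_coordE // -coord_change.
Qed.

Section TangentBundle.
Context (M : manifold).

Definition tangent_dom (i : chart_index M) : set (tangent_vector M) :=
  [set p | dom i (base p)].

Definition tangent_chart (i : chart_index M) (p : tangent_vector M) :
  (model M i * model M i)%type := (chart i (base p), coord p i).

Definition tangent_chart_inv (i : chart_index M)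
  (y : (model M i * model M i)%type) : tangent_vector M :=
  vector_at (chart_inv i y.1) y.2.

Fact tangent_cover p : exists i, tangent_dom i p.
Proof. by have [i ip] := dom_cover (base p); exists i. Qed.

Fact tangent_chartK i p : tangent_dom i p ->
  tangent_chart_inv (tangent_chart i p) = p.
Proof.
by move=> ip; rewrite /tangent_chart_inv /= chartK // vector_atK.
Qed.

Lemma tangent_overlap i j :
  tangent_chart i @` (tangent_dom i `&` tangent_dom j) =
  (chart i @` (dom i `&` dom j)) `*` setT.
Proof.
apply/seteqP; split=> [_ [p [ip jp] <-]|[y w] [[x [ix jx] /= xy] _]].
  by split => //=; exists (base p).
exists (vector_at x w) => //.
rewrite /tangent_chart vector_at_coordE //= xy -xy diff_trans_id //.
Qed.

Fact tangent_open i j :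
  open (tangent_chart i @` (tangent_dom i `&` tangent_dom j)).
Proof. by rewrite tangent_overlap; apply: openXT; exact: open_overlap. Qed.

Fact tangent_transition i j :
  regular_on r (tangent_chart i @` (tangent_dom i `&` tangent_dom j))
    (tangent_chart j \o @tangent_chart_inv i).
Proof.
rewrite tangent_overlap; set U := _ @` _.
have oU : open U by exact: open_overlap.
apply: regular_ext (regular_tangent oU (regular_transition i j)).
  exact: openXT.
move=> [_ w] [/= [x [ix jx] <-] _].
by rewrite /tangent_fun /tangent_chart /= chartK //
  -[vector_at_coord _ _ _]/(coord (vector_at _ _) _) vector_at_coordE.
Qed.

Definition tangent_bundle : manifold :=
  @Manifold R k r (tangent_vector M) (chart_index M)
    (fun i => (model M i * model M i)%type) tangent_dom tangent_chart
    tangent_chart_inv tangent_cover tangent_chartK tangent_open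
    tangent_transition.

End TangentBundle.

Notation T := tangent_bundle.

Definition chart_at M (x : M) : chart_index M := projT1 (cid (dom_cover x)).

Lemma dom_chart_at M (x : M) : dom (chart_at x) x.
Proof. exact: projT2 (cid (dom_cover x)). Qed.

(* The tangent map, computed in some charts around [base p] and [f (base p)]; *)
(* by [coord_tangent_map] it does not depend on them.                         *)
Definition tangent_map_fun M N (f : hom M N) (p : T M) : T N :=
  let i := chart_at (base p) in let j := chart_at (f (base p)) in
  vector_at (f (base p)) ('d (rep f i j) (chart i (base p)) (coord p i)).

Lemma coord_tangent_map M N (f : hom M N) (p : T M)
    (i : chart_index M) (j : chart_index N) : dom i (base p) -> dom j (f (base p)) ->
  coord (tangent_map_fun f p) j = 'd (rep f i j) (chart i (base p)) (coord p i).
Proof.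
move=> ip jp; rewrite vector_at_coordE //; last exact: dom_chart_at.
rewrite diff_trans_rep //; try exact: dom_chart_at.
by rewrite [coord p i](coord_change (dom_chart_at _)) // diff_rep_trans //;
  exact: dom_chart_at.
Qed.

Lemma open_dom_image M (i : chart_index M) : open (chart i @` dom i).
Proof. by have := open_overlap i i; rewrite setIid. Qed.

Lemma dom_image_overlap M N (f : M -> N) (i : chart_index M) (j : chart_index N) :
  (forall x, dom i x -> dom j (f x)) ->
  chart i @` dom i `<=` chart i @` (dom i `&` f @^-1` dom j).
Proof. by move=> ij _ [x ix <-]; exists x => //; split => //; exact: ij. Qed.

Lemma is_morphism_linear M N (f : M -> N) :
  (forall x, exists i j, exists L : {linear model M i -> model N j},
    [/\ dom i x, continuous L & forall y, dom i y ->
        dom j (f y) /\ chart j (f y) = L (chart i y)]) ->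
  is_morphism f.
Proof.
move=> H x; have [i [j [L [ix cL fL]]]] := H x.
exists i, j, (chart i @` dom i); split.
- by have [? _] := fL _ ix.
- exact: open_dom_image.
- by exists x.
- by apply: dom_image_overlap => y /fL[].
- apply: regular_ext (regular_linear _ (open_dom_image i) cL); first exact: open_dom_image.
  by move=> _ [y iy <-]; rewrite rep_chart //; have [_ ->] := fL _ iy.
Qed.

Fact tangent_mapP M N (f : hom M N) : is_morphism (tangent_map_fun f).
Proof.
move=> p; have [i [j [W [[ip jp] oW Wp WD rW]]]] := homP f (base p).
exists i, j, (W `*` setT); split => //.
- exact: openXT.
- move=> [y w] [/= /WD[x [ix jx] xy] _].
  exists (vector_at x w) => //; rewrite /= /tangent_chart vector_at_coordE //=.
  by rewrite diff_trans_id // xy.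
- apply: regular_ext (regular_tangent oW rW); first exact: openXT.
  move=> [y w] [/= /WD[x [ix jx] <-] _].
  rewrite /rep /= /tangent_chart_inv /= chartK //.
  rewrite /tangent_chart (coord_tangent_map (i := i)) // vector_at_coordE //.
  by rewrite diff_trans_id // /tangent_fun /= chartK.
Qed.

Definition tangent_map M N (f : hom M N) : hom (T M) (T N) := Hom (tangent_mapP f).

(* tau_M *)
Fact tangent_projP M : is_morphism (@base M : T M -> M).
Proof.
apply: is_morphism_linear => p; have [i ip] := dom_cover (base p).
exists i, i, fst; split => //; exact: fst_continuous_lin.
Qed.

Definition tangent_proj M : hom (T M) M := Hom (@tangent_projP M).

Definition zero_vector M (x : M) : T M :=
  @TangentVector M x (fun i => 0) (fun i _ => erefl)
    (fun i j _ _ => esym (linear0 ('d (trans i j) (chart i x)))).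

(* zeta_M *)
Fact zero_sectionP M : is_morphism (@zero_vector M).
Proof.
apply: is_morphism_linear => x; have [i ix] := dom_cover x.
pose L (y : model M i) : (model M i * model M i)%type := (y, 0).
have Llin : linear L by move=> c y z; rewrite /L; congr (_, _); rewrite /= scaler0 addr0.
pose LM := GRing.isLinear.Build _ _ _ _ _ Llin.
pose LL : {linear model M i -> (model M i * model M i)%type} := HB.pack L LM.
exists i, i, LL; split => //.
move=> y; have -> : LL = (fun y => (y, 0)) :> (_ -> _) by [].
by apply: cvg_pair; [exact: cvg_id|exact: cvg_cst].
Qed.

Definition zero_section M : hom M (T M) := Hom (@zero_sectionP M).

Section FibreSum.
Context M (p q : T M) (pq : base p = base q).

Fact fibre_sum_out i : ~ dom i (base p) -> coord p i + coord q i = 0.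
Proof. by move=> ip; rewrite !coord_out ?addr0 // -pq. Qed.

Fact fibre_sum_change i j : dom i (base p) -> dom j (base p) ->
  coord p j + coord q j = 'd (trans i j) (chart i (base p)) (coord p i + coord q i).
Proof.
move=> ip jp; rewrite linearD -coord_change //; congr (_ + _).
by move: ip jp; rewrite pq => ip jp; exact: coord_change.
Qed.

Definition fibre_sum : T M := TangentVector fibre_sum_out fibre_sum_change.

End FibreSum.

(* (tau T + T tau)_M; both terms are tangent vectors at tau_M (tau_TM xi). *)
Definition tangent_add_fun M (xi : T (T M)) : T M :=
  @fibre_sum M (tangent_proj (T M) xi) (tangent_map (tangent_proj M) xi) erefl.

Lemma chart_tangent_add M (xi : T (T M)) (i : chart_index M) :
  dom (i : chart_index (T (T M))) xi ->
  chart (i : chart_index (T M)) (tangent_add_fun xi) =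
  (fun y : (model M i * model M i) * (model M i * model M i) =>
    (y.1.1, y.1.2 + y.2.1)) (chart (i : chart_index (T (T M))) xi).
Proof.
move=> ixi; rewrite /= /tangent_chart /=; congr (_, _ + _).
rewrite -[LHS]/(coord (tangent_map_fun (tangent_proj M) xi) i).
rewrite (coord_tangent_map (i := (i : chart_index (T M)))) //.
set c := chart _ _; set w := coord xi _.
have cE : c = tangent_chart i (base xi) by [].
have [_ ->] : differentiable (rep (tangent_proj M) (i : chart_index (T M)) i) c /\
    'd (rep (tangent_proj M) (i : chart_index (T M)) i) c
      = 'd (@fst (model M i) (model M i)) c :> (_ -> _).
  apply: (@diff_near_on _ _ _ _ _ ((chart i @` dom i) `*` setT)).
  - exact/openXT/open_dom_image.
  - move=> [_ v] [/= [x ix <-] _].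
    by rewrite /rep /= /tangent_chart_inv /= chartK.
  - by split => //; exists (base (base xi)).
  - apply: linear_differentiable; exact: fst_continuous_lin.
by rewrite diff_lin //; exact: fst_continuous_lin.
Qed.

Fact tangent_addP M : is_morphism (@tangent_add_fun M).
Proof.
apply: is_morphism_linear => xi; have [i ix] := dom_cover (base (base xi)).
pose E : normedModType (scalar R k) := model M i.
pose L (y : (E * E) * (E * E)) : (E * E)%type := (y.1.1, y.1.2 + y.2.1).
have Llin : linear L.
  move=> c [[a b] [a' b']] [[d e] [d' e']]; rewrite /L /=; congr (_, _).
  change (c *: b + e + (c *: a' + d') = c *: (b + a') + (e + d')).
  by rewrite scalerDr addrACA.
pose LM := GRing.isLinear.Build _ _ _ _ _ Llin.
pose LL : {linear ((E * E) * (E * E))%type -> (E * E)%type} := HB.pack L LM.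
exists i, i, LL; split => //; last first.
  by move=> eta ieta; split => //; rewrite chart_tangent_add.
move=> y; have -> : LL = (fun y => (y.1.1, y.1.2 + y.2.1)) :> (_ -> _) by [].
apply: cvg_pair.
  by apply: (@continuous_comp _ _ _ fst fst); exact: cvg_fst.
apply: cvgD.
  by apply: (@continuous_comp _ _ _ fst snd); [exact: cvg_fst|exact: cvg_snd].
by apply: (@continuous_comp _ _ _ snd fst); [exact: cvg_snd|exact: cvg_fst].
Qed.

Definition tangent_add M : hom (T (T M)) (T M) := Hom (@tangent_addP M).

(* Naturality of [alpha : id => T] and [beta : T^2 => T], followed by the     *)
(* monad laws; equalities of morphisms are stated pointwise.                  *)
Definition is_tangent_monad (alpha : forall M, hom M (T M))
    (beta : forall M, hom (T (T M)) (T M)) :=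
  [/\ (forall M N (f : hom M N) (x : M),
        alpha N (f x) = tangent_map f (alpha M x)),
      (forall M N (f : hom M N) (xi : T (T M)),
        beta N (tangent_map (tangent_map f) xi) = tangent_map f (beta M xi)),
      (forall M (p : T M), beta M (alpha (T M) p) = p),
      (forall M (p : T M), beta M (tangent_map (alpha M) p) = p) &
      (forall M (w : T (T (T M))),
        beta M (beta (T M) w) = beta M (tangent_map (beta M) w))].

End Manifolds.

(* Main.v *)
(* Uniqueness: naturality along a constant map kills the fibre component of   *)
(* [alpha], so [alpha] is the zero section. A vector of T^2 M with            *)
(* coordinates (x, v, w, u) in a chart is the image under T^2 f of            *)
(* (0, e1, e2, 0), where f(s, t) = x + s v + t w + s t u near 0 in K^2. The   *)
(* coordinate projections K^2 -> K map (0, e1, e2, 0) to (0, 1, 0, 0) and     *)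
(* (0, 0, 1, 0), where the unit laws give [beta]; hence [beta] maps           *)
(* (0, e1, e2, 0) to (0, e1 + e2), and (x, v, w, u) to                        *)
(* (f(0), df_0(e1 + e2)) = (x, v + w).                                        *)

From HB Require Import structures.
From mathcomp Require Import all_boot all_order all_algebra complex.
From mathcomp Require Import boolp classical_sets reals topology.
From mathcomp Require Import prodnormedzmodule normedtype sequences derive.
Require Import Defs.

Set Implicit Arguments.
Unset Strict Implicit.
Unset Printing Implicit Defensive.

Import Order.TTheory GRing.Theory Num.Theory.
Import numFieldNormedType.Exports.

Local Open Scope classical_set_scope.
Local Open Scope ring_scope.

(** Naturality propagates the value of a transformation from one vector to all its images, so
    explicit test morphisms suffice. A constant map has zero differential, which forces [alpha] to
    be the zero section ([unit_zero_section]). A second tangent vector is the image of one generic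
    vector under [T^2] of a curved map defined near 0 in the plane, whose mixed second derivative
    supplies the second-order coordinate ([tangent_fun2_quadratic]). On the generic vector, [beta]
    is read off through the two coordinate projections: each reduces it to a vector covered by one
    of the unit laws ([chart_mult_generic]). Transporting the result back determines [beta]
    ([mult_tangent_add]). That the standard data form a monad ([tangent_monad]) rests on
    functoriality ([tangent_map_square]) and fibrewise linearity ([tangent_map_additive]) of tangent
    maps. The test maps are at most quadratic in charts, so one argument serves all scalars and both
    regularity classes ([regular_quadratic]). *)

(** * The scalar field as a Banach space *)

Section ScalarComplete.
Context (R : realType).

Lemma normci : `|'i%C| = 1 :> R[i].
Proof. by rewrite normc_def /= expr0n expr1n add0r sqrtr1. Qed.

Lemma Re_normB (x y : R[i]) : (`|complex.Re x - complex.Re y|%:C)%C <= `|x - y|.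
Proof. by rewrite -raddfB; exact: normc_ge_Re. Qed.

Lemma Im_normB (x y : R[i]) : (`|complex.Im x - complex.Im y|%:C)%C <= `|x - y|.
Proof.
(* Multiplication by [-i] preserves the modulus and turns imaginary parts into real parts. *)
have H (z : R[i]) : complex.Im z = complex.Re (- (z * 'i)%C).
  by rewrite raddfN /= ReiNIm opprK.
rewrite !H; apply: le_trans (Re_normB _ _) _.
by rewrite -opprD normrN -mulrBl normrM normci mulr1.
Qed.

Lemma complex_norm_le (x : R[i]) :
  `|x| <= (`|complex.Re x|%:C)%C + (`|complex.Im x|%:C)%C.
Proof.
rewrite {1}[x]complexE; apply: le_trans (ler_normD _ _) _.
rewrite normrM normci mul1r.
have H (a : R) : `|(a%:C)%C| = (`|a|%:C)%C.
  by rewrite normc_def /= expr0n /= addr0 sqrtr_sqr.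
by rewrite !H.
Qed.

Lemma complex_complete (F : set_system (scalar R ComplexScalars)) :
  ProperFilter F -> cauchy F -> cvg F.
Proof.
move=> PF /cauchyP cF.
pose re : scalar R ComplexScalars -> R := @complex.Re R.
pose im : scalar R ComplexScalars -> R := @complex.Im R.
have c1 : cvg (re @ F).
  apply/cauchy_cvgP/cauchyP => e e0.
  have /cF[x Fx] : 0 < (e%:C)%C by rewrite ltcR.
  exists (re x); rewrite /fmap /=; apply: filterS Fx => y /=.
  rewrite -!ball_normE /= => xy.
  have {}xy : `|(x : R[i]) - y| < (e%:C)%C by [].
  by rewrite -ltcR; apply: le_lt_trans (Re_normB _ _) xy.
have c2 : cvg (im @ F).
  apply/cauchy_cvgP/cauchyP => e e0.
  have /cF[x Fx] : 0 < (e%:C)%C by rewrite ltcR.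
  exists (im x); rewrite /fmap /=; apply: filterS Fx => y /=.
  rewrite -!ball_normE /= => xy.
  have {}xy : `|(x : R[i]) - y| < (e%:C)%C by [].
  by rewrite -ltcR; apply: le_lt_trans (Im_normB _ _) xy.
apply/cvg_ex; exists (Complex (lim (re @ F)) (lim (im @ F))).
apply/cvgrPdist_le => -[e e'].
(* A positive element of [R[i]] has imaginary part 0, so the radius is real. *)
rewrite ltcE /= => /andP[/eqP -> {e'}] e0.
have e20 : 0 < e / 2 by rewrite divr_gt0.
move/cvgrPdist_le: c1 => /(_ _ e20) c1; move/cvgrPdist_le: c2 => /(_ _ e20) c2.
apply: filterS2 c1 c2 => -[a b] cx1 cx2.
apply: le_trans (complex_norm_le _) _.
by rewrite -rmorphD lecR [leRHS]splitr; apply: lerD; [exact: cx1|exact: cx2].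
Qed.

Lemma scalar_complete k (F : set_system (scalar R k)) :
  ProperFilter F -> cauchy F -> cvg F.
Proof. by case: k F; [exact: R_complete|exact: complex_complete]. Qed.

(** Models of manifolds are complete normed modules. The carrier stays the field itself, so that
    coordinates in the plane can act as scalars. *)
Definition scalar_line k : completeNormedModType (scalar R k) :=
  let sK := Num.NumField.sort (scalar R k) in
  HB.pack sK
    (Uniform_isComplete.Build sK (@scalar_complete k)).

End ScalarComplete.

(** * Differential calculus of bounded quadratic maps *)

Section Quadratic.
Context (K : numFieldType).
Implicit Types E F : normedModType K.

Lemma linear_fun_add E F (l : E -> F) x y :
  linear l -> l (x + y) = l x + l y.
Proof. by move=> ll; have := ll 1 x y; rewrite !scale1r. Qed.

(* This class is closed under f |-> ((x, v) |-> 'd f x v), which gives its    *)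
(* smoothness by induction on the order of differentiability.                 *)
Record quadratic E F (f : E -> F) (c : F) (L : E -> F) (B : E -> E -> F) (C : K) :
    Prop := Quadratic {
  quadraticE : forall y, f y = c + L y + B y y;
  quadratic_linear : linear L;
  quadratic_bilinl : forall y, linear (B^~ y);
  quadratic_bilinr : forall x, linear (B x);
  quadratic_bound_ge0 : 0 <= C;
  quadratic_bound1 : forall x, `|L x| <= C * `|x|;
  quadratic_bound2 : forall x y, `|B x y| <= C * `|x| * `|y|
}.

Section Differential.
Context E F (f : E -> F) c L B C (qf : quadratic f c L B C).

Lemma quadratic_expand x h :
  f (x + h) = f x + (L h + (B x h + B h x)) + B h h.
Proof.
rewrite !(quadraticE qf) (linear_fun_add _ _ (quadratic_linear qf)).
rewrite (linear_fun_add _ _ (quadratic_bilinr qf _)).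
rewrite !(linear_fun_add _ _ (quadratic_bilinl qf _)) !addrA.
by rewrite [LHS](ACl (1*2*4*3*6*5*7)%AC).
Qed.

Lemma quadratic_dlinear x : linear (fun h => L h + (B x h + B h x)).
Proof.
move=> a h k; rewrite (quadratic_linear qf) (quadratic_bilinr qf).
rewrite (quadratic_bilinl qf) !scalerDr !addrA.
by rewrite [LHS](ACl (1*3*5*2*4*6)%AC).
Qed.

Lemma quadratic_dbound x h :
  `|L h + (B x h + B h x)| <= (C + 2 * (C * `|x|)) * `|h|.
Proof.
apply: le_trans (ler_normD _ _) _; rewrite mulrDl.
apply: lerD (quadratic_bound1 qf _) _.
apply: le_trans (ler_normD _ _) _; rewrite -mulrA mulr_natl mulr2n.
apply: lerD; first exact: (quadratic_bound2 qf).
by rewrite mulrAC; exact: (quadratic_bound2 qf).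
Qed.

(** The remainder of the expansion at [x] is exactly [B h h], of size at most [C * |h|^2]. As [B]
    need not be symmetric, both [B x h] and [B h x] occur. *)
Lemma quadratic_diff x : differentiable f x /\
  'd f x = (fun h => L h + (B x h + B h x)) :> (E -> F).
Proof.
pose l h := L h + (B x h + B h x).
pose lM := GRing.isLinear.Build _ _ _ _ _ (quadratic_dlinear x : linear l).
pose ll : {linear E -> F} := HB.pack l lM.
have C0 := quadratic_bound_ge0 qf.
have cl : continuous ll.
  apply: (lin_bound_cont (M := C + 2 * (C * `|x|))); last exact: quadratic_dbound.
  by rewrite addr_ge0 // !mulr_ge0.
have C1 : 0 < C + 1 by rewrite ltr_wpDl.
suff [] : differentiable f x /\ 'd f x = ll :> (E -> F) by [].
apply: diffP_eps => // e e0; near=> h.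
rewrite [h + x]addrC quadratic_expand -[ll h]/(l h) -/(l h).
have -> : f x + l h + B h h - f x - l h = B h h.
  by rewrite [LHS](ACl (3*(1*4)*(2*5))%AC) /= !subrr !addr0.
apply: le_trans (quadratic_bound2 qf _ _) _; rewrite ler_wpM2r //.
(* [C + 1] replaces [C], which may vanish. *)
have : `|h| <= e / (C + 1) by near: h; apply: nbhs0_le; rewrite divr_gt0.
rewrite ler_pdivlMr // mulrC; apply: le_trans.
by rewrite ler_wpM2r // lerDl.
Unshelve. all: by end_near. Qed.

Lemma quadratic_d :
  quadratic (fun p : E * E => 'd f (p.1) (p.2)) 0 (fun p => L p.2)
    (fun p q => B p.1 q.2 + B q.2 p.1) (C + C).
Proof.
have C0 := quadratic_bound_ge0 qf.
split.
- by move=> [x h] /=; have [_ ->] := quadratic_diff x; rewrite add0r.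
- by move=> a p q; rewrite /= (quadratic_linear qf).
- move=> p a q s /=; rewrite (quadratic_bilinl qf) (quadratic_bilinr qf).
  by rewrite scalerDr addrACA.
- move=> p a q s /=; rewrite (quadratic_bilinr qf) (quadratic_bilinl qf).
  by rewrite scalerDr addrACA.
- by rewrite addr_ge0.
- move=> p; apply: le_trans (quadratic_bound1 qf _) _.
  by apply: ler_pM => //; [rewrite lerDl|exact: norm_snd].
- move=> p q; apply: le_trans (ler_normD _ _) _; rewrite !mulrDl.
  apply: lerD; apply: le_trans (quadratic_bound2 qf _ _) _; rewrite -!mulrA.
    apply: ler_wpM2l => //; apply: ler_pM => //; [exact: norm_fst|exact: norm_snd].
  rewrite [`|p| * _]mulrC.
  apply: ler_wpM2l => //; apply: ler_pM => //; [exact: norm_snd|exact: norm_fst].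
Qed.

End Differential.

Lemma tangent_fun_quadratic E F (f : E -> F) c L B C x v :
  quadratic f c L B C -> tangent_fun f (x, v) = (f x, L v + (B x v + B v x)).
Proof. by move=> qf; rewrite /tangent_fun /=; have [_ ->] := quadratic_diff qf x. Qed.

(** By [quadratic_d], the differential is again quadratic and can be differentiated at [(x, v)]
    along [(w, u)]. The term [B w v + B v w] is the second derivative of [f] on [(w, v)]. *)
Lemma tangent_fun2_quadratic E F (f : E -> F) c L B C x v w u :
  quadratic f c L B C ->
  tangent_fun (tangent_fun f) ((x, v), (w, u)) =
  ((f x, L v + (B x v + B v x)),
   (L w + (B x w + B w x), L u + (B x u + B u x + (B w v + B v w)))).
Proof.
move=> qf; rewrite {1}/tangent_fun /= (tangent_fun_quadratic _ _ qf); congr (_, _).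
have [df dfE] := quadratic_diff qf x.
have [dD dDE] := quadratic_diff (quadratic_d qf) (x, v).
have [dP dPE] := @diff_linear_comp _ (E * E)%type E F f fst (x, v)
  (@fst_continuous_lin _ E E) df.
have -> : tangent_fun f = fun p => ((f \o fst) p, 'd f (p.1) (p.2)) by [].
by rewrite diff_pair //= dPE dDE /= dfE.
Qed.

Lemma quadratic_of_linear E F (L : E -> F) C : linear L -> 0 <= C ->
  (forall x, `|L x| <= C * `|x|) -> quadratic L 0 L (fun _ _ => 0) C.
Proof.
move=> lL C0 bL; split => //.
- by move=> y; rewrite add0r addr0.
- by move=> y a p q; rewrite scaler0 addr0.
- by move=> y a p q; rewrite scaler0 addr0.
- by move=> x y; rewrite normr0 !mulr_ge0.
Qed.

Lemma Ck_quadratic n E F (f : E -> F) c L B C (U : set E) :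
  quadratic f c L B C -> Ck n U f.
Proof.
elim: n E F f c L B C U => [|n IH] E F f c L B C U qf /=.
  by move=> x _; apply: differentiable_continuous; have [] := quadratic_diff qf x.
split; first by move=> x _; have [] := quadratic_diff qf x.
exact: IH (quadratic_d qf).
Qed.

Lemma analytic_quadratic E F (f : E -> F) c L B C (U : set E) :
  quadratic f c L B C -> analytic_on U f.
Proof.
move=> qf x _; have C0 := quadratic_bound_ge0 qf.
pose a n : ('I_n -> E) -> F := match n return ('I_n -> E) -> F with
  | 0 => fun=> f x
  | 1 => fun v => L (v ord0) + (B x (v ord0) + B (v ord0) x)
  | 2 => fun v => B (v ord0) (v ord_max)
  | _ => fun=> 0 end.
pose D := C + 2 * (C * `|x|).
have D0 : 0 <= D by rewrite addr_ge0 // !mulr_ge0.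
(* The expansion is finite, so radius 1 will do; the three summands bound the terms of orders 0, 1
   and 2. *)
exists a, (`|f x| + D + C), 1; split => //.
- case=> [|[|[|n]]] i v t y z /=; first by case: i.
  + by rewrite /upd !ord1 eqxx; exact: (quadratic_dlinear qf).
  + have [->|->] : i = ord0 \/ i = ord_max.
      by case: i => -[|[|//]] p; [left|right]; apply/val_inj.
    * by rewrite /upd /= (quadratic_bilinl qf).
    * by rewrite /upd /= (quadratic_bilinr qf).
  + by rewrite scaler0 addr0.
- case=> [|[|[|n]]] v; rewrite invr1 expr1n mulr1 /=.
  + by rewrite big_ord0 mulr1 -addrA lerDl addr_ge0.
  + rewrite big_ord1; apply: le_trans (quadratic_dbound qf _ _) _.
    by rewrite ler_wpM2r // [`|_| + _]addrC -addrA lerDl addr_ge0.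
  + rewrite big_ord_recl big_ord1 mulrA.
    rewrite (_ : lift ord0 ord0 = ord_max); last exact/val_inj.
    apply: le_trans (quadratic_bound2 qf _ _) _.
    by rewrite !ler_wpM2r // lerDr addr_ge0.
  + by rewrite normr0 mulr_ge0 ?prodr_ge0 // addr_ge0 // addr_ge0.
move=> h _; apply: cvg_near_cst; near=> n.
(* [series] at [n] sums the indices below [n], so it is constant from 3 on. *)
have n2 : (2 < n)%N by near: n; exists 3%N.
have [m ->] : exists m, n = m.+3 by exists (n - 3)%N; rewrite -addn3 subnK.
rewrite /series /= !big_nat_recl //= big1_seq ?addr0 //.
by rewrite (quadratic_expand qf) addrA.
Unshelve. all: by end_near. Qed.

End Quadratic.

Lemma regular_quadratic (R : realType) k r (E F : completeNormedModType (scalar R k))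
    (f : E -> F) c L B C (U : set E) :
  quadratic f c L B C -> regular_on r U f.
Proof.
by case: r => qf; [move=> n; exact: Ck_quadratic qf|exact: analytic_quadratic qf].
Qed.

(** * Functoriality of [T] and the standard monad *)

Section TangentFunctor.
Context (R : realType) (k : scalar_kind) (r : regularity).
Local Notation manifold := (manifold R k r).
Implicit Types M N P : manifold.

Local Notation T := tangent_bundle.

Lemma coord_tangent_mapE M N (f : hom M N) (p : T M) i j :
  dom i (base p) -> dom j (f (base p)) ->
  coord (tangent_map f p) j =
  'd (@rep _ _ _ M N f i j) (chart i (base p)) (coord p i).
Proof. exact: coord_tangent_map. Qed.

(** Chain rule in charts; the composite enters as a bare function, so equal composites can be
    exchanged by rewriting. *)
Lemma coord_tangent_map_comp M N P (f : hom M N) (g : hom N P) (p : T M) i l :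
  dom i (base p) -> dom l (g (f (base p))) ->
  coord (tangent_map g (tangent_map f p)) l =
  'd (@rep _ _ _ M P (g \o f) i l) (chart i (base p)) (coord p i).
Proof.
move=> ip lp; have [j jp] := dom_cover (f (base p)).
rewrite (coord_tangent_mapE (i := j)) // (coord_tangent_mapE (i := i)) //.
have df := rep_diff ip jp; have dg := rep_diff jp lp.
rewrite -(rep_chart f j ip) in dg *.
have dgf := differentiable_comp df dg.
have [_ ->] : differentiable (@rep _ _ _ M P (g \o f) i l) (chart i (base p)) /\
    'd (@rep _ _ _ M P (g \o f) i l) (chart i (base p)) =
    'd (@rep _ _ _ N P g j l \o @rep _ _ _ M N f i j) (chart i (base p)) :> (_ -> _).
  apply: diff_near => //; near=> y.
  have [z [iz jz] <-] : (chart i @` (dom i `&` f @^-1` dom j)) y.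
    by near: y; exact: near_rep.
  by rewrite /= !rep_chart.
by rewrite diff_comp.
Unshelve. all: by end_near. Qed.

Lemma tangent_map_square M N N' P (f : hom M N) (g : hom N P)
    (f' : hom M N') (g' : hom N' P) :
  g \o f =1 g' \o f' ->
  tangent_map g \o tangent_map f =1 tangent_map g' \o tangent_map f'.
Proof.
move=> /funext E p; apply: tangent_vector_eq => [|l lp].
  exact: (congr1 (fun h : M -> P => h (base p)) E).
have [i ip] := dom_cover (base p).
rewrite [LHS](coord_tangent_map_comp (i := i)) // E.
rewrite [RHS](coord_tangent_map_comp (i := i)) //.
by move: lp => /=; rewrite -[g (f _)]/((g \o f) _) E.
Qed.

Lemma tangent_map_retract M N (f : hom M N) (g : hom N M) :
  cancel f g -> cancel (tangent_map f) (tangent_map g).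
Proof.
move=> E p; apply: tangent_vector_eq => [|l lp]; first exact: E.
have [i ip] := dom_cover (base p).
rewrite (coord_tangent_map_comp (i := i)) //.
have -> : g \o f = id by apply/funext => x; exact: E.
(* The representative of the identity is a change of charts. *)
move: lp; rewrite /= E => lp; rewrite -coord_change //.
Qed.

Lemma tangent_map_zero M N (f : hom M N) x :
  tangent_map f (zero_section M x) = zero_section N (f x).
Proof.
have [i ix] := dom_cover x.
apply: tangent_vector_eq => // l lx.
by rewrite (coord_tangent_mapE (i := i)) //= linear0.
Qed.

Lemma coord_tangent_add M (xi : T (T M)) i :
  coord (tangent_add M xi) i =
  coord (base xi) i + coord (tangent_map (tangent_proj M) xi) i.
Proof. by []. Qed.

(** Differentials are linear. Describing the sum [s] by its components avoids the proof carried by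
    [fibre_sum]. *)
Lemma tangent_map_additive M N (f : hom M N) (p q s : T M) :
  base p = base q -> base s = base q ->
  (forall i, coord s i = coord p i + coord q i) ->
  forall j, coord (tangent_map f s) j =
    coord (tangent_map f p) j + coord (tangent_map f q) j.
Proof.
move=> pq sq spq j; have [i iq] := dom_cover (base q).
have [jq|njq] := pselect (dom j (f (base q))); last first.
  by rewrite !coord_out ?addr0 //= ?pq ?sq.
rewrite !(coord_tangent_mapE (i := i)) ?pq ?sq // spq linearD //.
Qed.

Lemma tangent_add_natural M N (f : hom M N) (xi : T (T M)) :
  tangent_add N (tangent_map (tangent_map f) xi) =
  tangent_map f (tangent_add M xi).
Proof.
apply: tangent_vector_eq => // j _; rewrite coord_tangent_add.
have -> : tangent_map (tangent_proj N) (tangent_map (tangent_map f) xi) =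
    tangent_map f (tangent_map (tangent_proj M) xi).
  exact: (tangent_map_square (g' := f)).
by symmetry; apply: tangent_map_additive.
Qed.

Lemma tangent_add_zero M (p : T M) : tangent_add M (zero_section (T M) p) = p.
Proof.
apply: tangent_vector_eq => // j _.
by rewrite coord_tangent_add tangent_map_zero /= addr0.
Qed.

Lemma tangent_add_tangent_zero M (p : T M) :
  tangent_add M (tangent_map (zero_section M) p) = p.
Proof.
apply: tangent_vector_eq => // j _.
by rewrite coord_tangent_add tangent_map_retract //= add0r.
Qed.

(** Write tau for projections and mu for the sum. Both sides are a sum of three vectors:
    [base (base w)], [T tau] of [base w], and [T tau] of [T tau_T w]. The last summands agree
    because [tau mu = tau tau_T]. *)
Lemma tangent_add_assoc M (w : T (T (T M))) :
  tangent_add M (tangent_add (T M) w) =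
  tangent_add M (tangent_map (tangent_add M) w).
Proof.
apply: tangent_vector_eq => // j _; rewrite 2!coord_tangent_add.
rewrite -[X in _ = X + _]/(coord (tangent_add M (base w)) j).
rewrite coord_tangent_add -addrA; congr (_ + _).
rewrite (@tangent_map_additive _ _ _ (base w)
  (tangent_map (tangent_proj (T M)) w)) //.
congr (_ + _).
rewrite -[RHS]/(coord ((_ \o _) _) _).
by rewrite (tangent_map_square (f' := tangent_proj (T M)) (g' := tangent_proj M)).
Qed.

Lemma tangent_monad :
  is_tangent_monad (fun M : manifold => zero_section M)
    (fun M : manifold => tangent_add M).
Proof.
split.
- by move=> M N f x; rewrite tangent_map_zero.
- exact: tangent_add_natural.
- exact: tangent_add_zero.
- exact: tangent_add_tangent_zero.
- exact: tangent_add_assoc.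
Qed.

End TangentFunctor.

(** * Tangent maps computed from explicit formulas in charts *)

Section LocalRepresentative.
Context (R : realType) (k : scalar_kind) (r : regularity).
Local Notation manifold := (manifold R k r).
Implicit Types M N : manifold.

Local Notation T := tangent_bundle.

(** Unlike [rep f i j], the map [g] is a closed formula on the whole model space, which can be
    differentiated directly; it only has to describe [f] on [W]. *)
Definition local_rep M N (f : M -> N) (i : chart_index M) (j : chart_index N)
    (W : set (model M i)) (g : model M i -> model N j) :=
  [/\ open W, regular_on r W g & forall y, W y -> exists x,
     [/\ dom i x, chart i x = y, dom j (f x) & chart j (f x) = g y]].

Lemma local_repE M N (f : M -> N) i j W g x :
  @local_rep M N f i j W g -> dom i x -> W (chart i x) ->
  dom j (f x) /\ chart j (f x) = g (chart i x).
Proof.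
move=> [_ _ H] ix /H[y [iy yx jy <-]].
by rewrite -(chartK ix) -yx chartK.
Qed.

Lemma local_rep_morphism M N (f : M -> N) :
  (forall x, exists i j W g,
     [/\ @local_rep M N f i j W g, dom i x & W (chart i x)]) ->
  is_morphism f.
Proof.
move=> H x; have [i [j [W [g [fg ix Wx]]]]] := H x.
have [jx _] := local_repE fg ix Wx; have [oW rg gf] := fg.
exists i, j, W; split => //.
  by move=> y /gf[z [iz <- jz _]]; exists z.
apply: regular_ext rg => // y /gf[z [iz <- jz <-]].
by rewrite rep_chart.
Qed.

Lemma tangent_chart_vector_at M (i : chart_index M) x (w : model M i) :
  dom i x -> tangent_chart i (vector_at x w) = (chart i x, w).
Proof.
by move=> ix; rewrite /tangent_chart vector_at_coordE // diff_trans_id.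
Qed.

(** On the open set [W], [g] agrees with [rep f i j], hence has the same differential there. Applied
    twice, this computes [T^2 f]. *)
Lemma local_rep_tangent M N (f : hom M N) i j W g :
  @local_rep M N f i j W g ->
  @local_rep (T M) (T N) (tangent_map f) i j (W `*` setT) (tangent_fun g).
Proof.
move=> [oW rg gf]; split; [exact: openXT|exact: regular_tangent|].
move=> [y h] [/= Wy _]; have [x [ix xy jx fx]] := gf y Wy.
exists (vector_at x h); split => //=; first by rewrite tangent_chart_vector_at // xy.
rewrite /tangent_chart (coord_tangent_map (i := i)) //= /tangent_fun /=.
rewrite -[vector_at_coord _ _ _]/(tangent_chart i (vector_at x h)).2.
rewrite tangent_chart_vector_at //= fx; congr (_, _).
have grep z : W z -> g z = @rep _ _ _ M N f i j z.
  by move=> /gf[t [it <- jt <-]]; rewrite rep_chart.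
by rewrite xy; have [_ ->] := diff_near_on oW grep Wy (regular_diff rg Wy).
Qed.

Lemma chart_inj M (i : chart_index M) x y :
  dom i x -> dom i y -> chart i x = chart i y -> x = y.
Proof. by move=> ix iy xy; rewrite -(chartK ix) xy chartK. Qed.

Lemma zero_pair_quadratic (E : completeNormedModType (scalar R k)) :
  quadratic (fun y : E => (y, 0 : E)) 0 (fun y => (y, 0)) (fun _ _ => 0) 1.
Proof.
apply: quadratic_of_linear => // [a x y|x].
  by congr (_, _); rewrite /= scaler0 addr0.
by rewrite mul1r; apply: ler_norm_pair; rewrite ?normr0.
Qed.

Lemma zero_section_local_rep M (i : chart_index M) :
  @local_rep M (T M) (zero_section M) i i (chart i @` dom i) (fun y => (y, 0)).
Proof.
split; first exact: open_dom_image.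
  exact: regular_quadratic (zero_pair_quadratic _).
by move=> _ [x ix <-]; exists x.
Qed.

Lemma chart_tangent_zero M (i : chart_index M) (p : T M) : dom i (base p) ->
  tangent_chart (i : chart_index (T M)) (tangent_map (zero_section M) p) =
  ((chart i (base p), 0), (coord p i, 0)).
Proof.
move=> ip.
have [||_] := local_repE (x := p) (local_rep_tangent (zero_section_local_rep i)) => //.
  by split => //; exists (base p).
move=> /= ->; rewrite (tangent_fun_quadratic _ _ (zero_pair_quadratic _)).
by rewrite !addr0.
Qed.

End LocalRepresentative.

(** * Open subsets of Banach spaces as manifolds with one chart *)

Section OpenSubmanifold.
Context (R : realType) (k : scalar_kind) (r : regularity).
Context (E : completeNormedModType (scalar R k)) (U : set E).
Context (oU : open U) (o : {y | U y}).

(** The inverse chart must be total; [o] is its default value outside [U]. *)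
Definition open_chart_inv (_ : unit) (y : E) : {y | U y} :=
  if pselect (U y) is left Uy then exist _ y Uy else o.

Let chart0 (_ : unit) (y : {y | U y}) : E := sval y.

Fact open_cover_proof (x : {y | U y}) : exists i : unit, [set: {y | U y}] x.
Proof. by exists tt. Qed.

Fact open_chartK i (x : {y | U y}) : setT x -> open_chart_inv i (chart0 i x) = x.
Proof.
case: x => x Ux _; rewrite /open_chart_inv /chart0 /=; case: pselect => // Ux'.
by congr exist; exact: Prop_irrelevance.
Qed.

Lemma open_chart_range i : chart0 i @` (setT `&` setT) = U.
Proof.
apply/seteqP; split => [_ [[y Uy] _ <-] //|y Uy].
by exists (exist _ y Uy).
Qed.

Fact open_chart_open (i j : unit) : open (chart0 i @` (setT `&` setT)).
Proof. by rewrite open_chart_range. Qed.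

Fact open_chart_transition i j :
  regular_on r (chart0 i @` (setT `&` setT)) (chart0 j \o open_chart_inv i).
Proof.
rewrite open_chart_range.
have rid : regular_on r U (idfun : E -> E).
  by apply: regular_linear => // y; exact: cvg_id.
apply: regular_ext rid => // y Uy.
by rewrite /= /open_chart_inv; case: pselect.
Qed.

Definition open_submanifold : manifold R k r :=
  @Manifold R k r {y | U y} unit (fun=> E) (fun=> setT) chart0 open_chart_inv
    open_cover_proof open_chartK open_chart_open open_chart_transition.

Section TangentRep.
Context (N : manifold R k r) (f : hom open_submanifold N) (j : chart_index N).
Context (g : E -> model N j).
Context (fg : @local_rep _ _ _ open_submanifold N f tt j U g).
Local Notation T := tangent_bundle.

Lemma open_tangent_mapE (q : T open_submanifold) :
  dom j (base (tangent_map f q)) /\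
  tangent_chart j (tangent_map f q) =
  tangent_fun g (tangent_chart (tt : chart_index open_submanifold) q).
Proof.
apply: (local_repE (x := q) (local_rep_tangent fg)) => //.
by split => //; exact: (svalP (base q)).
Qed.

Lemma open_tangent_map2E (q : T (T open_submanifold)) :
  dom j (base (base (tangent_map (tangent_map f) q))) /\
  tangent_chart (j : chart_index (T N)) (tangent_map (tangent_map f) q) =
  tangent_fun (tangent_fun g)
    (tangent_chart (tt : chart_index (T open_submanifold)) q).
Proof.
apply: (local_repE (x := q) (local_rep_tangent (local_rep_tangent fg))) => //.
by do 2 split => //; exact: (svalP (base (base q))).
Qed.

End TangentRep.

End OpenSubmanifold.

(** * Test morphisms and uniqueness of the monad *)

Section Uniqueness.
Context (R : realType) (k : scalar_kind) (r : regularity).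
Local Notation manifold := (manifold R k r).
Local Notation K := (scalar R k).
Local Notation line := (scalar_line R k).
Local Notation plane := (line * line)%type.
Implicit Types M N : manifold.

Local Notation T := tangent_bundle.

Definition line_manifold : manifold :=
  @open_submanifold R k r line setT openT (exist _ 0 I).

Section Surface.
Context (E : completeNormedModType K) (x v w u : E).

Definition surface_lin (y : plane) : E := (y.1 : K) *: v + (y.2 : K) *: w.

(** The diagonal gives the term [s t u], and the symmetrization takes the value [u] on the two basis
    vectors. *)
Definition surface_bilin (y z : plane) : E := ((y.1 : K) * (z.2 : K)) *: u.

Definition surface (y : plane) : E := x + surface_lin y + surface_bilin y y.

Lemma surface_quadratic :
  quadratic (surface : plane -> E) x surface_lin surface_bilin (`|v| + `|w| + `|u|).
Proof.
have C0 : 0 <= `|v| + `|w| + `|u| by rewrite !addr_ge0.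
split => //.
- move=> a [y1 y2] [z1 z2]; rewrite /surface_lin /=.
  rewrite !scalerDl -!scalerA scalerDr.
  by rewrite addrACA.
- move=> y a [p1 p2] [q1 q2]; rewrite /surface_bilin /=.
  by rewrite mulrDl scalerDl -[a *: p1]/((a : K) * p1) -mulrA -scalerA.
- move=> y a [p1 p2] [q1 q2]; rewrite /surface_bilin /=.
  by rewrite mulrDr scalerDl -[a *: p2]/((a : K) * p2) scalerA mulrCA.
- move=> y; rewrite /surface_lin !mulrDl; apply: ler_wpDr.
    by rewrite mulr_ge0.
  apply: le_trans (ler_normD _ _) _; rewrite !normrZ ![_ * `|y|]mulrC.
  by apply: lerD; apply: ler_wpM2r => //; [exact: norm_fst|exact: norm_snd].
- move=> y z; rewrite /surface_bilin normrZ normrM.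
  rewrite mulrC -mulrA; apply: ler_pM; rewrite ?mulr_ge0 ?lerDr ?addr_ge0 //.
  by apply: ler_pM => //; [exact: norm_fst|exact: norm_snd].
Qed.

Lemma surface_continuous : continuous (surface : plane -> E).
Proof.
move=> y; apply: differentiable_continuous.
by have [] := quadratic_diff surface_quadratic y.
Qed.

End Surface.

(* [surface] takes values in the chart only near 0, hence the open subset.    *)
Section Probe.
Context M (i : chart_index M) (x : M) (ix : dom i x) (v w u : model M i).

Local Notation P := (surface (chart i x) v w u : plane -> model M i).

Definition probe_dom : set plane := P @^-1` (chart i @` dom i).

Lemma probe_dom_open : open probe_dom.
Proof.
by apply: open_comp; [move=> y _; exact: surface_continuous|exact: open_dom_image].
Qed.

Lemma surface0 : P 0 = chart i x.
Proof. by rewrite /surface /surface_lin /surface_bilin /= mul0r !scale0r !addr0. Qed.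

Lemma probe_dom0 : probe_dom 0.
Proof. by rewrite /probe_dom /= surface0; exists x. Qed.

Definition probe_source : manifold :=
  open_submanifold r probe_dom_open (exist _ 0 probe_dom0).

Definition probe_fun (y : probe_source) : M := chart_inv i (P (sval y)).

Lemma probe_local_rep : @local_rep _ _ _ probe_source M probe_fun tt i probe_dom P.
Proof.
split; first exact: probe_dom_open.
  exact: regular_quadratic (surface_quadratic _ _ _ _).
move=> y Uy; exists (exist _ y Uy); split => //; rewrite /probe_fun /=;
by have [z iz <-] := Uy; rewrite chartK.
Qed.

Fact probeP : is_morphism probe_fun.
Proof.
apply: local_rep_morphism => y; exists tt, i, probe_dom, P.
by split => //; [exact: probe_local_rep|exact: (svalP y)].
Qed.

Definition probe : hom probe_source M := Hom probeP.

Section Coordinate.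
Context (L : plane -> line) (lL : linear L) (bL : forall y, `|L y| <= 1 * `|y|).

(** [L] will be each of the two projections; jointly they detect tangent vectors of the plane. *)
Definition coordinate_fun (y : probe_source) : line_manifold :=
  exist _ (L (sval y)) I.

Let qL := quadratic_of_linear lL ler01 bL.

Lemma coordinate_local_rep :
  @local_rep _ _ _ probe_source line_manifold coordinate_fun tt tt probe_dom L.
Proof.
split; [exact: probe_dom_open|exact: regular_quadratic qL|].
by move=> y Uy; exists (exist _ y Uy).
Qed.

Fact coordinateP : is_morphism coordinate_fun.
Proof.
apply: local_rep_morphism => y; exists tt, tt, probe_dom, L.
by split => //; [exact: coordinate_local_rep|exact: (svalP y)].
Qed.

Definition coordinate : hom probe_source line_manifold := Hom coordinateP.

Lemma coordinate_tangent (q : T probe_source) a b :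
  tangent_chart (tt : chart_index probe_source) q = (a, b) ->
  tangent_chart (tt : chart_index line_manifold) (tangent_map coordinate q) =
  (L a, L b).
Proof.
move=> qab.
have [_ ->] := open_tangent_mapE (f := coordinate) coordinate_local_rep q.
by rewrite qab (tangent_fun_quadratic _ _ qL) !addr0.
Qed.

Lemma coordinate_tangent2 (q : T (T probe_source)) a b c d :
  tangent_chart (tt : chart_index (T probe_source)) q = ((a, b), (c, d)) ->
  tangent_chart (tt : chart_index (T line_manifold))
    (tangent_map (tangent_map coordinate) q) = ((L a, L b), (L c, L d)).
Proof.
move=> qab.
have [_ ->] := open_tangent_map2E (f := coordinate) coordinate_local_rep q.
by rewrite qab (tangent_fun2_quadratic _ _ _ _ qL) !addr0.
Qed.

End Coordinate.

Definition generic_vector : T (T probe_source) :=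
  @vector_at _ _ _ (T probe_source) tt
    (@vector_at _ _ _ probe_source tt (exist _ 0 probe_dom0) (1, 0))
    ((0, 1), 0).

Lemma chart_generic_vector :
  tangent_chart (tt : chart_index (T probe_source)) generic_vector =
  ((0, (1, 0)), ((0, 1), 0)).
Proof.
rewrite tangent_chart_vector_at //; congr (_, _).
exact: tangent_chart_vector_at.
Qed.

End Probe.

Section Monad.
Context (alpha : forall M, hom M (T M)) (beta : forall M, hom (T (T M)) (T M)).
Context (monad_ab : is_tangent_monad alpha beta).

Lemma unit_zero_section M : alpha M = zero_section M.
Proof.
apply: hom_eq => x; have [alpha_nat _ _ _ _] := monad_ab.
have [i ix] := dom_cover x.
(* With all coefficients zero the probe is constant with value [x]. *)
pose f := probe ix 0 0 0.
pose y0 : probe_source ix 0 0 0 := exist _ 0 (probe_dom0 ix 0 0 0).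
have fx : f y0 = x by rewrite /= /probe_fun /= surface0 chartK.
have := alpha_nat _ _ f y0; rewrite fx => ->.
set q := alpha _ y0.
have [iq qE] := open_tangent_mapE (f := f) (probe_local_rep ix 0 0 0) q.
apply: (@chart_inj _ _ _ (T M) i) => //.
rewrite /= qE (tangent_fun_quadratic _ _ (surface_quadratic _ _ _ _)).
rewrite /surface /surface_lin /surface_bilin !scaler0 !addr0 //.
Qed.

Let unit_law1 M p : beta M (zero_section (T M) p) = p.
Proof. by have [_ _ h _ _] := monad_ab; rewrite -unit_zero_section. Qed.

Let unit_law2 M p : beta M (tangent_map (zero_section M) p) = p.
Proof. by have [_ _ _ h _] := monad_ab; rewrite -unit_zero_section. Qed.

Let beta_natural M N (f : hom M N) (xi : T (T M)) :
  beta N (tangent_map (tangent_map f) xi) = tangent_map f (beta M xi).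
Proof. by have [_ h _ _ _] := monad_ab. Qed.

(** Naturality along each projection reduces [beta] to the line, where a unit law evaluates it. *)
Lemma chart_mult_generic M (i : chart_index M) (x : M) (ix : dom i x)
    (v w u : model M i) :
  tangent_chart (tt : chart_index (probe_source ix v w u))
    (beta _ (generic_vector ix v w u)) = (0, (1, 1)).
Proof.
have fst_lin : linear (fst : plane -> line) by [].
have snd_lin : linear (snd : plane -> line) by [].
have fst_le (y : plane) : `|y.1| <= 1 * `|y| by rewrite mul1r; exact: norm_fst.
have snd_le (y : plane) : `|y.2| <= 1 * `|y| by rewrite mul1r; exact: norm_snd.
pose e : T line_manifold := @vector_at _ _ _ line_manifold tt (exist _ 0 I) 1.
have eE : tangent_chart (tt : chart_index line_manifold) e = (0, 1).
  exact: tangent_chart_vector_at.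
set xi := generic_vector ix v w u.
have xiE := chart_generic_vector ix v w u.
(* The first projection sends [xi] to [((0, 1), (0, 0))], the zero vector at [e]. *)
have e1 : tangent_map (coordinate ix v w u fst_lin fst_le) (beta _ xi) = e.
  rewrite -beta_natural -[RHS]unit_law1; congr (beta _ _).
  apply: (@chart_inj _ _ _ (T (T line_manifold)) tt) => //.
  rewrite /= (coordinate_tangent2 fst_lin fst_le xiE) /=.
  by rewrite /tangent_chart /= -/(tangent_chart _ e) eE.
(* The second sends [xi] to [((0, 0), (1, 0))], the image of [e] under the tangent map of the zero
   section. *)
have e2 : tangent_map (coordinate ix v w u snd_lin snd_le) (beta _ xi) = e.
  rewrite -beta_natural -[RHS]unit_law2; congr (beta _ _).
  apply: (@chart_inj _ _ _ (T (T line_manifold)) tt) => //.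
  rewrite /= (coordinate_tangent2 snd_lin snd_le xiE) /=.
  rewrite chart_tangent_zero //.
  by rewrite -[coord _ _]/(tangent_chart (tt : chart_index line_manifold) e).2 eE.
case qE: (tangent_chart _ _) => [[a1 a2] [b1 b2]].
have := coordinate_tangent fst_lin fst_le qE; rewrite e1 eE => /= -[<- <-].
by have := coordinate_tangent snd_lin snd_le qE; rewrite e2 eE => /= -[<- <-].
Qed.

Lemma mult_tangent_add M : beta M = tangent_add M.
Proof.
apply: hom_eq => xi; have [i ix] := dom_cover (base (base xi)).
set v := coord (base xi) i; set wu := coord xi (i : chart_index (T M)).
pose f := probe ix v wu.1 wu.2; pose xi0 := generic_vector ix v wu.1 wu.2.
have [i0 xi0E] := open_tangent_map2E (f := f) (probe_local_rep ix v wu.1 wu.2) xi0.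
(* The coefficients of the probe are the coordinates of [xi]; the last one, [wu.2], comes from the
   bilinear term. *)
have xiE : tangent_map (tangent_map f) xi0 = xi.
  apply: (@chart_inj _ _ _ (T (T M)) i) => //.
  rewrite /= xi0E chart_generic_vector.
  rewrite (tangent_fun2_quadratic _ _ _ _ (surface_quadratic _ _ _ _)).
  rewrite surface0 /surface_lin /surface_bilin /=.
  rewrite !(mul0r, mulr0, mulr1, scale0r, scale1r, addr0, add0r).
  by rewrite /tangent_chart /= /tangent_chart -surjective_pairing.
rewrite -{1}xiE beta_natural.
have [iq qE] := open_tangent_mapE (f := f) (probe_local_rep ix v wu.1 wu.2)
  (beta _ xi0).
apply: (@chart_inj _ _ _ (T M) i) => //.
rewrite chart_tangent_add //= qE chart_mult_generic.
(* At 0 the bilinear terms vanish, so the differential sends [(1, 1)] to [v + wu.1]. *)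
rewrite (tangent_fun_quadratic _ _ (surface_quadratic _ _ _ _)).
rewrite surface0 /surface_lin /surface_bilin /=.
by rewrite !(mul0r, mulr0, mulr1, scale0r, scale1r, addr0, add0r).
Qed.

End Monad.

End Uniqueness.

Theorem proposition2p2p1 (R : realType) (k : scalar_kind) (r : regularity) :
  is_tangent_monad (fun M : manifold R k r => zero_section M)
    (fun M : manifold R k r => tangent_add M) /\
  (forall (alpha : forall M : manifold R k r, hom M (tangent_bundle M))
          (beta : forall M : manifold R k r,
             hom (tangent_bundle (tangent_bundle M)) (tangent_bundle M)),
     is_tangent_monad alpha beta ->
     (forall M : manifold R k r, alpha M = zero_section M) /\
     (forall M : manifold R k r, beta M = tangent_add M)).
Proof.
split; first exact: tangent_monad.
move=> alpha beta ab; split => M; first exact: (unit_zero_section ab).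
exact: (mult_tangent_add ab).
Qed.
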